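(* Assume (A1)--(A4) below and let $\delta\in(0,1)$. Let $(x^k,\mathbf y^k,\mathbf z^k)_{k\ge0}$ be generated by Walkman, either in the proximal variant with $\beta\ge\max\{\gamma,2L+2\}$, or in the gradient variant with $\beta>\max\{\gamma,2L^2+L+2\}$, with local variables initialized so that $\nabla f_i(y_i^0)=\beta y_i^0=z_i^0$ for all $i\in\{1,\dots,n\}$. Then there exists a sequence $(g^k)_{k\ge0}$ with $g^k\in\partial L_\beta^{k+1}$ such that $$\min_{k\le K}\mathbb E\|g^k\|^2\le\frac{\bar C}{K}\big(L_\beta^0-\underline f\big),\qquad\forall K>\tau(\delta)+2,$$ where $\bar C$ is a constant merely depending on $\beta,L,\gamma$ and $n,\tau(\delta)$. With $\beta,L,\gamma$ independent from the network structure, one has $\bar C\sim O\Big(\frac{\tau(\delta)^2+1}{(1-\delta)n\pi_*}\Big)$.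
   Context: Setting. $V=\{1,\dots,n\}$ is the set of agents; $f_i:\mathbb R^p\to\mathbb R$ ($i\in V$) and $r:\mathbb R^p\to\mathbb R\cup\{+\infty\}$ are possibly nonconvex; the problem is $\min_{x\in\mathbb R^p} r(x)+\frac1n\sum_{i=1}^n f_i(x)$. Norms are Euclidean; $\partial$ is the general (limiting) subdifferential in the sense of Rockafellar--Wets. $\mathbf y=\mathrm{col}\{y_1,\dots,y_n\}\in\mathbb R^{np}$ and $\mathbf z=\mathrm{col}\{z_1,\dots,z_n\}\in\mathbb R^{np}$. The proximal operator is $\mathbf{prox}_{\alpha f}(x)=\arg\min_y f(y)+\frac1{2\alpha}\|y-x\|^2$. Augmented Lagrangian: $L_\beta(x,\mathbf y;\mathbf z)=r(x)+\frac1n\sum_{i=1}^n\big(f_i(y_i)+\langle z_i,x-y_i\rangle+\frac\beta2\|x-y_i\|^2\big)$. Write $L_\beta^k:=L_\beta(x^k,\mathbf y^k;\mathbf z^k)$ and let $\partial L_\beta^{k}$ be the subdifferential of $L_\beta$ with respect to $(x,\mathbf y,\mathbf z)$ at $(x^k,\mathbf y^k,\mathbf z^k)$. Walkman. Let $\beta>0$ and let $(i_k)_{k\ge0}$, $i_k\in V$, be the random walk. Initialize $y_i^0,z_i^0$ so that $\bar x^1=\frac1n\sum_{i=1}^n(y_i^0-z_i^0/\beta)=0$ (this holds under the initialization in the claim). For $k=0,1,2,\dots$: (a) $x^{k+1}=\mathbf{prox}_{\frac1\beta r}(\bar x^{k+1})$; (b) proximal variant: $y_{i_k}^{k+1}=\mathbf{prox}_{\frac1\beta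 f_{i_k}}\big(x^{k+1}+\frac{z_{i_k}^k}\beta\big)$; gradient variant: $y_{i_k}^{k+1}=x^{k+1}+\frac1\beta z_{i_k}^k-\frac1\beta\nabla f_{i_k}(y_{i_k}^k)$; in both variants $y_i^{k+1}=y_i^k$ for $i\ne i_k$; (c) $z_{i_k}^{k+1}=z_{i_k}^k+\beta(x^{k+1}-y_{i_k}^{k+1})$ and $z_i^{k+1}=z_i^k$ for $i\neq i_k$; (d) $\bar x^{k+2}=\bar x^{k+1}+\frac1n\big(y_{i_k}^{k+1}-\frac{z_{i_k}^{k+1}}\beta\big)-\frac1n\big(y_{i_k}^{k}-\frac{z_{i_k}^{k}}\beta\big)$. ($x^0$ is the initial point.) Assumptions. (A1) $(i_k)_{k\ge0}$ is an irreducible and aperiodic Markov chain on $V$ with transition matrix $\mathbf P$, $[\mathbf P]_{ij}=p(i_{k+1}=j\mid i_k=i)$, and stationary distribution $\pi$, $\pi^{\mathsf T}\mathbf P=\pi^{\mathsf T}$. (A2) The objective $r+\frac1n\sum_i f_i$ is bounded from below on $\mathbb R^p$, with lower bound $\underline f$, and coercive: it tends to $\infty$ along every sequence with $\|x^k\|\to\infty$. (A3) Each $f_i$ is $L$-Lipschitz differentiable: $\|\nabla f_i(u)-\nabla f_i(v)\|\le L\|u-v\|$ for all $u,v\in\mathbb R^p$. (A4) $r$ is lower semicontinuous and $\gamma$-semiconvex: $r+\frac\gamma2\|\cdot\|^2$ is convex, equivalently $r(y)+\frac\gamma2\|y-x\|^2\ge r(x)+\langle d,y-x\rangle$ for all $x,y$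 and all $d\in\partial r(x)$. Mixing time. $\pi_*:=\min_{i\in V}\pi_i$, $\sigma(\mathbf P):=\sup\{\|f^{\mathsf T}\mathbf P\|/\|f\|: f\in\mathbb R^n,\ f^{\mathsf T}\mathbf 1=0\}$, and $\tau(\delta):=\Big\lceil\frac1{1-\sigma(\mathbf P)}\ln\frac{\sqrt2}{\delta\pi_*}\Big\rceil$, chosen so that $|[\mathbf P^{\tau(\delta)}]_{ij}-\pi_j|\le\delta\pi_*$ for all $i,j\in V$.
   Formalization: In the proximal variant β>γ is required (still β≥2L+2): at β=γ the prox can be multivalued and the bound fails. C̄ may also depend on δ and π_*, since a C̄ depending only on β, L, γ, n, τ(δ) cannot have the claimed order. *)

(* Defs.v *)
From HB Require Import structures.
From mathcomp Require Export all_boot all_order all_algebra.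
From mathcomp Require Export all_classical all_reals all_analysis.
Export Order.TTheory GRing.Theory Num.Theory.
Export numFieldNormedType.Exports.

Set Implicit Arguments.
Unset Strict Implicit.
Unset Printing Implicit Defensive.

Local Open Scope classical_set_scope.
Local Open Scope ring_scope.

(* Points of R^p are row vectors, and the stacked vectors of R^{np} are n x p
   matrices whose i-th row is the i-th block.  MathComp-Analysis equips
   matrices with the sup norm, so the Euclidean structure is defined here; the
   two norms induce the same topology. *)
Definition edot (R : realType) (m p : nat) (u v : 'M[R]_(m, p)) : R :=
  \sum_(i < m) \sum_(j < p) u i j * v i j.

Definition enorm (R : realType) (m p : nat) (u : 'M[R]_(m, p)) : R :=
  Num.sqrt (edot u u).

Definition gradient (R : realType) (p : nat) (f : 'rV[R]_p -> R)
    (u : 'rV[R]_p) : 'rV[R]_p :=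
  \row_(j < p) 'D_(delta_mx 0 j) f u.

Definition regular_subdifferential (R : realType) (m p : nat)
    (h : 'M[R]_(m, p) -> \bar R) (u : 'M[R]_(m, p)) : set 'M[R]_(m, p) :=
  [set v | (h u \is a fin_num) /\
    forall e : R, 0 < e ->
      exists2 eta : R, 0 < eta &
        forall w : 'M[R]_(m, p), enorm (w - u) < eta ->
          (h u + (edot v (w - u) - e * enorm (w - u))%:E <= h w)%E].

(* The general (limiting) subdifferential of Rockafellar and Wets. *)
Definition subdifferential (R : realType) (m p : nat)
    (h : 'M[R]_(m, p) -> \bar R) (u : 'M[R]_(m, p)) : set 'M[R]_(m, p) :=
  [set v | (h u \is a fin_num) /\
    exists us vs : nat -> 'M[R]_(m, p),
      [/\ us @ \oo --> u,
          (fun k => h (us k)) @ \oo --> h u,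
          forall k, regular_subdifferential h (us k) (vs k)
        & vs @ \oo --> v]].

(* Set of minimizers; as usual for extended-valued functions, it is empty when
   the infimum is +oo. *)
Definition argmin (R : realType) (V : Type) (h : V -> \bar R) : set V :=
  [set u | (h u < +oo)%E /\ forall v, (h u <= h v)%E].

Definition prox (R : realType) (p : nat) (alpha : R) (h : 'rV[R]_p -> \bar R)
    (u : 'rV[R]_p) : set 'rV[R]_p :=
  argmin (fun v => (h v + ((2 * alpha)^-1 * enorm (v - u) ^+ 2)%:E)%E).

Definition objective (R : realType) (n p : nat) (f : 'I_n -> 'rV[R]_p -> R)
    (r : 'rV[R]_p -> \bar R) (u : 'rV[R]_p) : \bar R :=
  (r u + (n%:R^-1 * \sum_(i < n) f i u)%:E)%E.

Definition coercive (R : realType) (p : nat) (h : 'rV[R]_p -> \bar R) : Prop :=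
  forall us : nat -> 'rV[R]_p,
    (fun k => enorm (us k)) @ \oo --> +oo%R ->
    (fun k => h (us k)) @ \oo --> +oo%E.

Definition lipschitz_differentiable (R : realType) (p : nat) (L : R)
    (f : 'rV[R]_p -> R) : Prop :=
  (forall u, differentiable f u) /\
  (forall u v, enorm (gradient f u - gradient f v) <= L * enorm (u - v)).

Definition econvex (R : realType) (p : nat) (h : 'rV[R]_p -> \bar R) : Prop :=
  forall (u v : 'rV[R]_p) (t : R), 0 <= t <= 1 ->
    (h (t *: u + (1 - t) *: v)%R <= t%:E * h u + (1 - t)%:E * h v)%E.

Definition semiconvex (R : realType) (p : nat) (gamma : R)
    (r : 'rV[R]_p -> \bar R) : Prop :=
  econvex (fun u => (r u + (gamma / 2 * enorm u ^+ 2)%:E)%E).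

Definition aug_lagrangian (R : realType) (n p : nat)
    (f : 'I_n -> 'rV[R]_p -> R) (r : 'rV[R]_p -> \bar R) (beta : R)
    (x : 'rV[R]_p) (y z : 'M[R]_(n, p)) : \bar R :=
  (r x + (n%:R^-1 * \sum_(i < n)
     (f i (row i y) + edot (row i z) (x - row i y)
      + beta / 2 * enorm (x - row i y) ^+ 2))%:E)%E.

(* The variable (x, y, z) is stacked as a matrix with 1 + (n + n) rows, so that
   its Euclidean structure is that of R^p x R^{np} x R^{np}. *)
Definition stack (R : realType) (n p : nat) (x : 'rV[R]_p)
    (y z : 'M[R]_(n, p)) : 'M[R]_(1 + (n + n), p) :=
  col_mx x (col_mx y z).

Definition aug_lagrangian_joint (R : realType) (n p : nat)
    (f : 'I_n -> 'rV[R]_p -> R) (r : 'rV[R]_p -> \bar R) (beta : R)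
    (w : 'M[R]_(1 + (n + n), p)) : \bar R :=
  aug_lagrangian f r beta
    (usubmx w) (usubmx (dsubmx w)) (dsubmx (dsubmx w)).

Definition stochastic_mx (R : realType) (n : nat) (P : 'M[R]_n) : Prop :=
  (forall a b, 0 <= P a b) /\ (forall a, \sum_(b < n) P a b = 1).

Definition follows_path (T : Type) (n : nat) (ik : nat -> T -> 'I_n)
    (a : nat -> 'I_n) (k : nat) : set T :=
  [set w | forall t, (t <= k)%N -> ik t w = a t].

(* The last clause is the Markov property with transition matrix P,
   p(i_{k+1} = a_{k+1} | i_0 = a_0, ..., i_k = a_k) = P_{a_k a_{k+1}},
   multiplied out so that no conditioning on null events occurs. *)
Definition markov_chain (R : realType) (d : measure_display)
    (T : measurableType d) (Pr : probability T R) (n : nat)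
    (ik : nat -> T -> 'I_n) (P : 'M[R]_n) : Prop :=
  [/\ forall k j, measurable [set w | ik k w = j],
      stochastic_mx P
    & forall (a : nat -> 'I_n) (k : nat),
        Pr (follows_path ik a k.+1) =
        (Pr (follows_path ik a k) * (P (a k) (a k.+1))%:E)%E].

Definition irreducible (R : realType) (n : nat) (P : 'M[R]_n) : Prop :=
  forall a b, exists m : nat, 0 < (P ^+ m) a b.

Definition aperiodic (R : realType) (n : nat) (P : 'M[R]_n) : Prop :=
  forall (a : 'I_n) (q : nat),
    (forall m : nat, (0 < m)%N -> 0 < (P ^+ m) a a -> (q %| m)%N) -> q = 1%N.

Definition stationary (R : realType) (n : nat) (P : 'M[R]_n) (pi : 'rV[R]_n)
    : Prop :=
  [/\ forall a, 0 <= pi 0 a, \sum_(a < n) pi 0 a = 1 & pi *m P = pi].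

(* 1 is neutral here, because the entries of pi are at most 1. *)
Definition pi_min (R : realType) (n : nat) (pi : 'rV[R]_n) : R :=
  \big[Num.min/1]_(a < n) pi 0 a.

Definition sigma (R : realType) (n : nat) (P : 'M[R]_n) : R :=
  sup [set enorm (h *m P) / enorm h | h in
        [set h : 'rV[R]_n | h != 0 /\ \sum_(a < n) h 0 a = 0]].

(* tau = tau(delta).  The closed formula guarantees the mixing bound only when
   sigma(P) < 1, which irreducibility and aperiodicity do not imply for a
   nonreversible chain; the bound is therefore part of what it means to be
   tau(delta). *)
Definition is_mixing_time (R : realType) (n : nat) (P : 'M[R]_n)
    (pi : 'rV[R]_n) (delta : R) (tau : nat) : Prop :=
  tau%:Z = Num.ceil ((1 - sigma P)^-1
                     * exp.ln (Num.sqrt 2 / (delta * pi_min pi))) /\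
  forall a b, `|(P ^+ tau) a b - pi 0 b| <= delta * pi_min pi.

Variant variant := Proximal | Gradient.

(* In the proximal variant the inequality beta > gamma is strict: when
   beta = gamma the function r + beta/2 |.|^2 need not be strictly convex, the
   x-update need not have a unique minimizer, and x may keep jumping without
   any decrease of the augmented Lagrangian. *)
Definition admissible_beta (R : realType) (var : variant) (beta L gamma : R)
    : Prop :=
  match var with
  | Proximal => gamma < beta /\ 2 * L + 2 <= beta
  | Gradient => Num.max gamma (2 * L ^+ 2 + L + 2) < beta
  end.

Definition y_update (R : realType) (p : nat) (var : variant) (beta : R)
    (fi : 'rV[R]_p -> R) (x y z y' : 'rV[R]_p) : Prop :=
  match var with
  | Proximal => prox beta^-1 (fun u => (fi u)%:E) (x + beta^-1 *: z) y'
  | Gradient => y' = x + beta^-1 *: z - beta^-1 *: gradient fi y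
  end.

(* xbar is used from index 1 on.  The iterates are random only through ik. *)
Definition walkman (R : realType) (T : Type) (n p : nat) (var : variant)
    (beta : R) (f : 'I_n -> 'rV[R]_p -> R) (r : 'rV[R]_p -> \bar R)
    (ik : nat -> T -> 'I_n)
    (x0 : 'rV[R]_p) (y0 z0 : 'M[R]_(n, p))
    (x xbar : nat -> T -> 'rV[R]_p) (y z : nat -> T -> 'M[R]_(n, p)) : Prop :=
  forall w : T,
    [/\ x 0%N w = x0, y 0%N w = y0, z 0%N w = z0,
        xbar 1%N w =
          n%:R^-1 *: \sum_(i < n) (row i y0 - beta^-1 *: row i z0)
      & forall k : nat, let j := ik k w in
        [/\ prox beta^-1 r (xbar k.+1 w) (x k.+1 w),
            y_update var beta (f j) (x k.+1 w)
              (row j (y k w)) (row j (z k w)) (row j (y k.+1 w))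
            /\ (forall i, i != j -> row i (y k.+1 w) = row i (y k w)),
            row j (z k.+1 w) =
              row j (z k w) + beta *: (x k.+1 w - row j (y k.+1 w)),
            forall i, i != j -> row i (z k.+1 w) = row i (z k w)
          & xbar k.+2 w = xbar k.+1 w
              + n%:R^-1 *: (row j (y k.+1 w) - beta^-1 *: row j (z k.+1 w))
              - n%:R^-1 *: (row j (y k w) - beta^-1 *: row j (z k w))]].

(* Main.v *)
Require Import Defs.
From mathcomp Require Import ring lra.

(* Lyapunov argument followed by a mixing argument.  Each dual variable is a
   gradient, [z_i = grad f_i(u_i)], where [u_i] is the current local iterate
   [y_i] in the proximal variant and the previous one in the gradient variant.
   Along every trajectory
     [V = L_beta(x, y; z) + (L^2 + 1) / (2 n) * sum_i |y_i - u_i|^2]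
   stays above [flow] and decreases at each step by at least
   [(beta - gamma) / 2 |dx|^2 + kappa / n (|dy|^2 + |dz|^2)], so the squared
   increments are summable, with sum of order [n (L_beta^0 - flow)].

   The subgradient at iterate [k+1] is controlled by the last increment and by
   the residuals [|x - y_i| + |grad f_i(y_i) - z_i|] of all agents.  The residual
   of the agent that has just been visited is bounded by the last increment, and
   a residual changes at each step by at most a multiple of the increment; hence
   the residual at time [k+1] of the agent visited [tau] steps later is bounded by
   a window of [tau + 1] increments.  Conditionally on the walk up to time [k],
   every agent is that agent with probability at least [(1 - delta) pi_min], so
   the expected sum of all squared residuals is bounded by the expectation of a
   window of increments.  Looking ahead rather than back makes the bound valid for
   every [k], and summing over [k <= K] concludes.

   When [p = 0] the constant [L] may be negative, but then everything vanishes. *)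

Set Implicit Arguments.
Unset Strict Implicit.
Unset Printing Implicit Defensive.

Local Open Scope classical_set_scope.
Local Open Scope ring_scope.

(** * Euclidean structure and the descent lemma *)

Section Euclidean.
Variables (R : realType) (m p : nat).
Implicit Types (u v w : 'M[R]_(m, p)) (a b : R).

Lemma edotC u v : edot u v = edot v u.
Proof. by apply: eq_bigr => i _; apply: eq_bigr => j _; rewrite mulrC. Qed.

Lemma edotDl u v w : edot (u + v) w = edot u w + edot v w.
Proof.
rewrite -big_split; apply: eq_bigr => i _; rewrite -big_split.
by apply: eq_bigr => j _; rewrite mxE mulrDl.
Qed.

Lemma edotZl a u v : edot (a *: u) v = a * edot u v.
Proof.
rewrite mulr_sumr; apply: eq_bigr => i _; rewrite mulr_sumr.
by apply: eq_bigr => j _; rewrite mxE mulrA.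
Qed.

Lemma edotDr u v w : edot u (v + w) = edot u v + edot u w.
Proof. by rewrite edotC edotDl !(edotC u). Qed.

Lemma edotZr a u v : edot u (a *: v) = a * edot u v.
Proof. by rewrite edotC edotZl edotC. Qed.

Lemma edotNl u v : edot (- u) v = - edot u v.
Proof. by rewrite -scaleN1r edotZl mulN1r. Qed.

Lemma edotNr u v : edot u (- v) = - edot u v.
Proof. by rewrite edotC edotNl edotC. Qed.

Lemma edot0l u : edot 0 u = 0.
Proof. by rewrite -(scale0r 0) edotZl mul0r. Qed.

Definition edotE := (edotDl, edotDr, edotNl, edotNr, edotZl, edotZr).

Lemma edot_ge0 u : 0 <= edot u u.
Proof.
by apply: sumr_ge0 => i _; apply: sumr_ge0 => j _; rewrite -expr2 sqr_ge0.
Qed.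

Lemma edot_eq0 u : edot u u = 0 -> u = 0.
Proof.
move=> /eqP; rewrite psumr_eq0; last first.
  by move=> i _; apply: sumr_ge0 => j _; rewrite -expr2 sqr_ge0.
move=> /allP u0; apply/matrixP => i j; rewrite mxE.
have := u0 i (mem_index_enum i); rewrite psumr_eq0; last first.
  by move=> k _; rewrite -expr2 sqr_ge0.
by move=> /allP /(_ j (mem_index_enum j)); rewrite -expr2 sqrf_eq0 => /eqP.
Qed.

Lemma enorm_sq u : enorm u ^+ 2 = edot u u.
Proof. by rewrite sqr_sqrtr ?edot_ge0. Qed.

Lemma enorm_ge0 u : 0 <= enorm u.
Proof. exact: sqrtr_ge0. Qed.

Lemma enorm_eq0 u : enorm u = 0 -> u = 0.
Proof. by move=> u0; apply: edot_eq0; rewrite -enorm_sq u0 expr0n. Qed.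

Lemma enorm0 : enorm (0 : 'M[R]_(m, p)) = 0.
Proof. by rewrite /enorm edot0l sqrtr0. Qed.

Lemma enormN u : enorm (- u) = enorm u.
Proof. by rewrite /enorm edotNl edotNr opprK. Qed.

Lemma enormB u v : enorm (u - v) = enorm (v - u).
Proof. by rewrite -enormN opprB. Qed.

Lemma enormZ a u : enorm (a *: u) = `|a| * enorm u.
Proof. by rewrite /enorm edotZl edotZr mulrA -expr2 sqrtrM ?sqr_ge0// sqrtr_sqr. Qed.

Lemma cauchy_schwarz u v : edot u v <= enorm u * enorm v.
Proof.
have [u0|u0] := eqVneq (enorm u) 0.
  by rewrite u0 (enorm_eq0 u0) edot0l mul0r.
have [v0|v0] := eqVneq (enorm v) 0.
  by rewrite v0 (enorm_eq0 v0) edotC edot0l mulr0.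
(* Expanding this square and dividing by [2 |u| |v|], positive here, gives the inequality. *)
have := edot_ge0 (enorm v *: u - enorm u *: v).
rewrite !edotE -!enorm_sq (edotC v u) => h.
have uv : 0 < enorm u * enorm v by rewrite mulr_gt0// lt_def ?u0 ?v0 enorm_ge0.
rewrite -(ler_pM2l uv); nra.
Qed.

Lemma enormD u v : enorm (u + v) <= enorm u + enorm v.
Proof.
rewrite -(@ler_pXn2r _ 2) ?nnegrE ?addr_ge0 ?enorm_ge0//.
rewrite enorm_sq !edotE (edotC v u) -!enorm_sq.
by have := cauchy_schwarz u v; nra.
Qed.

Lemma edot_young u v : edot u v <= (enorm u ^+ 2 + enorm v ^+ 2) / 2.
Proof.
have := edot_ge0 (u - v).
by rewrite !edotE (edotC v u) !enorm_sq; lra.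
Qed.

Lemma enormD_sq u v : enorm (u + v) ^+ 2 <= 2 * (enorm u ^+ 2 + enorm v ^+ 2).
Proof.
have := edot_ge0 (u - v).
by rewrite !enorm_sq !edotE (edotC v u); lra.
Qed.

End Euclidean.

Section Rows.
Variables (R : realType) (m p : nat).
Implicit Types u v : 'M[R]_(m, p).

Lemma edot_rows u v : edot u v = \sum_(i < m) edot (row i u) (row i v).
Proof.
apply: eq_bigr => i _; rewrite /edot big_ord1.
by apply: eq_bigr => j _; rewrite !mxE.
Qed.

Lemma enorm_sq_rows u : enorm u ^+ 2 = \sum_(i < m) enorm (row i u) ^+ 2.
Proof.
by rewrite enorm_sq edot_rows; apply: eq_bigr => i _; rewrite enorm_sq.
Qed.

Lemma enorm_row u i : enorm (row i u) <= enorm u.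
Proof.
rewrite -(@ler_pXn2r _ 2) ?nnegrE ?enorm_ge0// enorm_sq_rows (bigD1 i)//= lerDl.
by apply: sumr_ge0 => j _; rewrite sqr_ge0.
Qed.

End Rows.

Lemma edot_col_mx (R : realType) (m1 m2 p : nat) (a c : 'M[R]_(m1, p))
    (b d : 'M[R]_(m2, p)) :
  edot (col_mx a b) (col_mx c d) = edot a c + edot b d.
Proof.
rewrite /edot big_split_ord/=; congr (_ + _); apply: eq_bigr => i _;
  by apply: eq_bigr => j _; rewrite ?col_mxEu ?col_mxEd.
Qed.

Section Smooth.
Variables (R : realType) (p : nat).
Implicit Types (u v w : 'rV[R]_p) (f : 'rV[R]_p -> R).

Lemma derive_gradient f u v : differentiable f u ->
  'D_v f u = edot (gradient f u) v.
Proof.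
move=> df; rewrite deriveE// {1}(matrix_sum_delta v) big_ord1 linear_sum/=.
rewrite /edot big_ord1; apply: eq_bigr => j _.
by rewrite linearZ/= !mxE -deriveE// mulrC.
Qed.

Lemma is_derive_line f u d (t : R) : differentiable f (t *: d + u) ->
  is_derive t 1 (fun t : R => f (t *: d + u)) (edot (gradient f (t *: d + u)) d).
Proof.
move=> df; rewrite -derive_gradient//.
have -> : 'D_d f (t *: d + u) = 'D_1 (fun t : R => f (t *: d + u)) t.
  rewrite /derive; apply: (congr1 (fun k => lim (k @ 0^'))); apply/funext => s /=.
  by rewrite scalerDl addrA [s *: (1 : R^o)]mulr1.
apply: derivableP; apply/derivable1_diffP.
apply: (@differentiable_comp _ _ _ _ (fun t : R => t *: d + u) f) => //.
Qed.

(** The sign [s] treats both halves of the descent lemma at once. The mean value theorem replaces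
    integration of the gradient along the segment. *)
Lemma descent_signed f L (s : R) u v : lipschitz_differentiable L f -> `|s| = 1 ->
  s * (f v - f u - edot (gradient f u) (v - u)) <= L / 2 * enorm (v - u) ^+ 2.
Proof.
move=> [df lipf] s1.
pose d := v - u; pose D := edot (gradient f u) d; pose g (t : R) := f (t *: d + u).
pose K := L / 2 * enorm d ^+ 2.
(* Subtracting [K t^2] rather than a linear term keeps the factor [L / 2]: the Lipschitz bound at
   time [t] is [t L |d|^2 = 2 K t], so [h] has a nonpositive derivative on the segment. *)
pose h : R -> R := s *: (g - D *: (id : R -> R)) - K *: ((id : R -> R) ^+ 2).
have dg (t : R) := is_derive_line (df (t *: d + u)).
have dh (t : R) : is_derive t 1 h (s * (edot (gradient f (t *: d + u)) d - D)
    - t * (2 * K)).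
  apply: is_derive_eq.
  rewrite /GRing.scale/= expr1; ring.
have [|c] := @MVT_segment R h _ 0 1 ler01 (fun t _ => dh t).
  apply: continuous_subspaceT => t.
  exact/differentiable_continuous/derivable1_diffP.
rewrite in_itv/= => /andP[c0 c1].
rewrite /h /g !fctE/= (scale0r d) (scale1r d) add0r {1}/d subrK.
have : enorm (c *: d) = c * enorm d by rewrite enormZ ger0_norm.
have : c *: d + u - u = c *: d by rewrite addrK.
move: (c *: d) => cd; move: (cd + u) => q qE cdE; rewrite /GRing.scale/= => fE.
suff : s * (edot (gradient f q) d - D) <= c * (2 * K).
  move: fE; rewrite -/d -/D -/K; lra.
rewrite /D -edotNl -edotDl -edotZl.
apply: le_trans (cauchy_schwarz _ _) _.
rewrite enormZ s1 mul1r.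
apply: le_trans (ler_wpM2r (enorm_ge0 _) (lipf _ _)) _.
by rewrite qE cdE /K; lra.
Qed.

Lemma descent_upper f L u v : lipschitz_differentiable L f ->
  f v <= f u + edot (gradient f u) (v - u) + L / 2 * enorm (v - u) ^+ 2.
Proof. by move=> /descent_signed /(_ (normr1 _)) => /(_ u v); lra. Qed.

Lemma descent_lower f L u v : lipschitz_differentiable L f ->
  f u + edot (gradient f u) (v - u) - L / 2 * enorm (v - u) ^+ 2 <= f v.
Proof.
by move=> /descent_signed /(_ (normrN1 _)) => /(_ u v); lra.
Qed.
End Smooth.

(** * Proximal steps and subgradients *)

Section Prox.
Variables (R : realType) (p : nat).
Implicit Types (u v w c x : 'rV[R]_p) (f : 'rV[R]_p -> R) (r : 'rV[R]_p -> \bar R).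

(** Let [G] be the gradient of the proximal objective at [u]. One gradient step of length
    [1 / (L + beta)] would lower this objective by at least [|G|^2 / (2 (L + beta))], so minimality
    forces [G = 0]. *)
Lemma prox_smooth_stationary f (L beta : R) c u :
  lipschitz_differentiable L f -> 0 < beta -> 0 < L + beta ->
  prox beta^-1 (fun v => (f v)%:E) c u -> gradient f u = beta *: (c - u).
Proof.
move=> lipf beta0 Lbeta [_ umin].
apply/eqP; rewrite -subr_eq0; apply/eqP; set G := _ - _.
have /= := umin (u - (L + beta)^-1 *: G).
rewrite -!EFinD lee_fin invfM invrK => h.
have := descent_upper u (u - (L + beta)^-1 *: G) lipf.
have GE : gradient f u = G + beta *: (c - u) by rewrite /G subrK.
rewrite GE (_ : u - (L + beta)^-1 *: G - u = - ((L + beta)^-1 *: G)); last first.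
  by rewrite addrAC subrr add0r.
move: h; rewrite (_ : u - _ - c = - (c - u) - (L + beta)^-1 *: G); last first.
  by rewrite opprB addrAC.
rewrite -(opprB c u) enormN.
clearbody G; move: (c - u) GE => D GE.
rewrite !enorm_sq !edotE (edotC D G).
set s := (L + beta)^-1 => h1 h2; apply: edot_eq0; apply/eqP.
rewrite eq_le edot_ge0 andbT.
have s0 : 0 < s by rewrite invr_gt0.
have sE : (L + beta) * s = 1 by rewrite mulfV// gt_eqF.
have : s * edot G G <= s * ((L + beta) * s) * (edot G G / 2) by lra.
rewrite sE mulr1 => h3.
by rewrite -(ler_pM2l s0) mulr0; lra.
Qed.

Lemma prox_fin r (alpha : R) c x : (forall u, r u != -oo%E) ->
  prox alpha r c x -> r x \is a fin_num.
Proof.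
by move=> rNy [+ _]; have := rNy x; case: (r x).
Qed.

Lemma prox_le r (beta : R) c x v : 0 < beta -> prox beta^-1 r c x ->
  (r x + (beta / 2 * enorm (x - c) ^+ 2)%:E
    <= r v + (beta / 2 * enorm (v - c) ^+ 2)%:E)%E.
Proof. by move=> b0 [_ /(_ v)]; rewrite invfM invrK [_^-1 * _]mulrC. Qed.

(** The proximal objective is strongly convex with modulus [beta - gamma], of either sign here.
    Comparing [x] with [t v + (1 - t) x], dividing by [t] and letting [t] tend to 0 gives the
    quadratic term. *)
Lemma prox_strong r (beta gamma : R) c x v : (forall u, r u != -oo%E) ->
  0 < beta -> semiconvex gamma r -> prox beta^-1 r c x -> r v \is a fin_num ->
  fine (r x) + beta / 2 * enorm (x - c) ^+ 2
    + (beta - gamma) / 2 * enorm (v - x) ^+ 2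
  <= fine (r v) + beta / 2 * enorm (v - c) ^+ 2.
Proof.
move=> rNy b0 rcvx xprox rvfin; have rxfin := prox_fin rNy xprox.
set K := (beta - gamma) / 2 * _.
suff ht t : 0 < t < 1 -> fine (r x) + beta / 2 * enorm (x - c) ^+ 2 + (1 - t) * K
    <= fine (r v) + beta / 2 * enorm (v - c) ^+ 2.
  (* For [K <= 0] a single [t] suffices, since [(1 - t) K >= K]. *)
  have [K0|K0] := leP K 0.
    by have := ht (2^-1) ltac:(lra); lra.
  apply/ler_addgt0Pr => e e0.
  pose t := Num.min (2^-1) (e / K).
  have t0 : 0 < t by rewrite /t lt_min divr_gt0// invr_gt0 ltr0n.
  have tK : t * K <= e by rewrite -ler_pdivlMr// ge_min lexx orbT.
  have t1 : t <= 2^-1 by rewrite ge_min lexx.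
  by have := ht t ltac:(lra); lra.
move=> /andP[t0 t1].
have t01 : 0 <= t <= 1 by rewrite !ltW.
have := rcvx v x t t01; have := prox_le (t *: v + (1 - t) *: x) b0 xprox.
have := rNy (t *: v + (1 - t) *: x).
rewrite -[r v]fineK// -[r x]fineK//=.
case: (r (_ + _)) => [a _||]//=; rewrite -?EFinD -?EFinM ?lee_fin.
set a1 := fine _; set a2 := fine _.
rewrite (_ : t *: v + (1 - t) *: x - c = t *: (v - c) + (1 - t) *: (x - c)); last first.
  rewrite !scalerBr addrACA -opprD -scalerDl addrCA subrr addr0 scale1r//.
rewrite /K (_ : v - x = (v - c) - (x - c)); last by rewrite opprB addrA subrK.
have : t *: v + (1 - t) *: x = t *: (v - c) + (1 - t) *: (x - c) + c.
  rewrite !scalerBr addrACA -opprD -scalerDl (addrC t) subrK scale1r subrK//.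
move=> ->.
move: (subrK c v) (subrK c x).
move: (v - c) (x - c) => V X <- <-.
rewrite !enorm_sq !edotE (edotC X V) (edotC c V) (edotC c X) => h1 h2.
rewrite -(ler_pM2l t0); lra.
Qed.

(** Adding the two strong minimality inequalities leaves [(beta - gamma) |x - x'|^2 <= 0].
    Uniqueness makes the [x]-iterates functions of the walk. *)
Lemma prox_unique r (beta gamma : R) c x x' : (forall u, r u != -oo%E) ->
  0 < beta -> gamma < beta -> semiconvex gamma r ->
  prox beta^-1 r c x -> prox beta^-1 r c x' -> x = x'.
Proof.
move=> rNy b0 gb rcvx px px'.
have := prox_strong rNy b0 rcvx px (prox_fin rNy px').
have := prox_strong rNy b0 rcvx px' (prox_fin rNy px).
rewrite (enormB x) => h1 h2.
apply/eqP; rewrite eq_sym -subr_eq0; apply/eqP/edot_eq0/eqP.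
rewrite -enorm_sq eq_le sqr_ge0 andbT.
have bg : 0 < beta - gamma by rewrite subr_gt0.
rewrite -(ler_pM2l bg) mulr0; lra.
Qed.

(** Expanding [|v - c|^2] around [x] turns minimality into a global quadratic minorant of [r] with
    slope [beta (c - x)]. *)
Lemma prox_subgradient r (beta : R) c x v : 0 < beta -> r x \is a fin_num ->
  prox beta^-1 r c x ->
  (r x + (edot (beta *: (c - x)) (v - x) - beta / 2 * enorm (v - x) ^+ 2)%:E
    <= r v)%E.
Proof.
move=> b0 rfin xprox; have := prox_le v b0 xprox.
rewrite -[r x]fineK//; case: (r v) => [a||]//=; rewrite -?EFinD ?lee_fin ?leey//.
rewrite (_ : v - c = (v - x) - (c - x)); last by rewrite opprB addrA subrK.
rewrite -(enormN (x - c)) opprB; move: (c - x) (v - x) => C V.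
rewrite !enorm_sq !edotE (edotC C V); lra.
Qed.

End Prox.

(** The minorant makes [g] a regular subgradient at [u] itself, so constant sequences witness the
    limiting one. *)
Lemma quadratic_minorant_subdifferential (R : realType) (m p : nat)
    (h : 'M[R]_(m, p) -> \bar R) (u g : 'M[R]_(m, p)) (C : R) :
  h u \is a fin_num ->
  (forall w, (h u + (edot g (w - u) - C * enorm (w - u) ^+ 2)%:E <= h w)%E) ->
  subdifferential h u g.
Proof.
move=> hfin hw; split=> //; exists (fun=> u), (fun=> g); split; try exact: cvg_cst.
(* On this ball [C |w - u|^2 <= e |w - u|]; the added 1 avoids a division by 0. *)
move=> _; split=> // e e0; exists (e / (1 + `|C|)).
  by rewrite divr_gt0// ltr_pwDl.
move=> w; rewrite ltr_pdivlMr ?ltr_pwDl// => we.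
apply: le_trans (hw w); rewrite leeD2l// lee_fin lerD2l lerN2.
rewrite expr2 mulrA ler_wpM2r ?enorm_ge0//.
have := enorm_ge0 (w - u); have := ler_norm C; nra.
Qed.

(** * The augmented Lagrangian *)

Section Lagrangian.
Variables (R : realType) (p : nat).
Implicit Types (u v x y z : 'rV[R]_p) (f : 'rV[R]_p -> R).

Definition local_lagrangian f (beta : R) x y z : R :=
  f y + edot z (x - y) + beta / 2 * enorm (x - y) ^+ 2.

(** Stationarity gives [grad f u - grad f v = beta (v - u)], hence [beta |u - v| <= L |u - v|] with
    [L < beta]. *)
Lemma prox_smooth_unique f (L beta : R) c u v :
  lipschitz_differentiable L f -> 0 <= L < beta ->
  prox beta^-1 (fun v => (f v)%:E) c u ->
  prox beta^-1 (fun v => (f v)%:E) c v -> u = v.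
Proof.
move=> lipf /andP[L0 Lb] pu pv.
have b0 : 0 < beta by lra.
have Lb0 : 0 < L + beta by lra.
have gu := prox_smooth_stationary lipf b0 Lb0 pu.
have gv := prox_smooth_stationary lipf b0 Lb0 pv.
have := lipf.2 u v; rewrite gu gv -scalerBr enormZ gtr0_norm//.
rewrite (_ : c - u - (c - v) = v - u); last by rewrite opprB addrC addrA subrK.
rewrite (enormB v) => h.
apply/eqP; rewrite -subr_eq0; apply/eqP/enorm_eq0/eqP.
rewrite eq_le enorm_ge0 andbT.
have bL : 0 < beta - L by lra.
by rewrite -(ler_pM2l bL) mulr0; lra.
Qed.

(** The slopes are the partial gradients. The descent lemma handles [f], Young's inequality the
    bilinear term [<dz, dx - dy>], and the [beta] square is convex. [A] stands for a nonnegative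
    bound on [L]. *)
Lemma local_lagrangian_minorant f (L A beta : R) x y z x' y' z' :
  lipschitz_differentiable L f -> 0 <= A -> L <= A -> 0 <= beta ->
  local_lagrangian f beta x y z + edot (z + beta *: (x - y)) (x' - x)
  + edot (gradient f y - z + beta *: (y - x)) (y' - y) + edot (x - y) (z' - z)
  - (1 + A / 2) * (enorm (x' - x) ^+ 2 + enorm (y' - y) ^+ 2
                      + enorm (z' - z) ^+ 2)
  <= local_lagrangian f beta x' y' z'.
Proof.
move=> lipf A0 LA b0; have := descent_lower y y' lipf; rewrite /local_lagrangian.
have -> : x' - y' = (x - y) + ((x' - x) - (y' - y)).
  by apply/matrixP => a b; rewrite !mxE; ring.
have -> : z' = z + (z' - z) by rewrite addrC subrK.
rewrite (addrC z (z' - z)) addrK -(opprB x y).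
move: (z' - z) (x' - x) (y' - y) (x - y) => dz dx dy D.
have L1 : L / 2 * enorm dy ^+ 2 <= A / 2 * enorm dy ^+ 2.
  by rewrite ler_wpM2r ?sqr_ge0// ler_pM2r ?invr_gt0.
have L2 : 0 <= A / 2 * (enorm dx ^+ 2 + enorm dz ^+ 2).
  by rewrite mulr_ge0 ?addr_ge0 ?sqr_ge0 ?divr_ge0.
have := edot_young (- dz) (dx - dy); have := enormD_sq dx (- dy).
rewrite !enormN => h1 h2.
have := mulr_ge0 b0 (sqr_ge0 (enorm (dx - dy))).
move: h2; rewrite edotNl.
move: h1 L1 L2; have := enorm_sq dx; have := enorm_sq dy; have := enorm_sq dz.
move: (gradient f y) => G.
rewrite !(enorm_sq (D + _)) !(enorm_sq (dx - dy)) !(enorm_sq D).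
rewrite !edotE !(edotC D dx) !(edotC D dy) !(edotC D dz) !(edotC dy dx).
have := edot_ge0 dz; lra.
Qed.

(* The term in [y - u] is the Lyapunov correction needed by the gradient variant,
   whose dual variable is the gradient at the previous local iterate [u]. *)
Definition local_potential f (L beta : R) x y z u : R :=
  local_lagrangian f beta x y z + (L ^+ 2 + 1) / 2 * enorm (y - u) ^+ 2.

(** The descent lemma from [y] to [x] uses the slope [grad f y], whereas the multiplier is
    [grad f u]. Young's inequality splits the mismatch: its [y - u] part is absorbed by the
    correction term, its [x - y] part by [beta >= L + 1]. *)
Lemma local_potential_ge f (L beta : R) x y u :
  lipschitz_differentiable L f -> L + 1 <= beta ->
  f x <= local_potential f L beta x y (gradient f u) u.
Proof.
move=> lipf Lb; rewrite /local_potential /local_lagrangian.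
have := descent_upper y x lipf.
have := edot_young (gradient f y - gradient f u) (x - y).
have := lipf.2 y u; move: (gradient f y) (gradient f u) => Gy Gu lip.
have lip2 : enorm (Gy - Gu) ^+ 2 <= L ^+ 2 * enorm (y - u) ^+ 2.
  by rewrite -exprMn ler_sqr ?nnegrE ?enorm_ge0// (le_trans (enorm_ge0 _) lip).
rewrite edotDl edotNl.
have : (L + 1) * enorm (x - y) ^+ 2 <= beta * enorm (x - y) ^+ 2.
  by rewrite ler_wpM2r ?sqr_ge0.
have := sqr_ge0 (enorm (y - u)); lra.
Qed.

(** Exact balance of one visit. The dual step costs [|z' - z|^2 / beta], because
    [x - y' = (z' - z) / beta]; the other terms are the effect of the primal step. *)
Lemma local_lagrangian_update f (beta : R) x y z y' z' : beta != 0 ->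
  z' = z + beta *: (x - y') ->
  local_lagrangian f beta x y z - local_lagrangian f beta x y' z'
  = f y - f y' + edot z' (y' - y) + beta / 2 * enorm (y' - y) ^+ 2
    - beta^-1 * enorm (z' - z) ^+ 2.
Proof.
move=> b0 zE; have -> : z' - z = beta *: (x - y') by rewrite zE addrC addKr.
rewrite /local_lagrangian enormZ exprMn real_normK ?num_real// zE.
rewrite (_ : x - y = (x - y') + (y' - y)); last by rewrite addrA subrK.
move: (x - y') (y' - y) => D dy.
by rewrite !enorm_sq !edotE (edotC dy D); field.
Qed.

(** The ascent caused by the dual step is paid through [|z' - z| <= L |u' - u|]: in the proximal
    variant by the decrease in [y], in the gradient variant by the correction term in [y - u]. *)
Lemma local_potential_decrease var f (L beta gamma : R) x y z u y' z' u' :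
  0 <= L -> admissible_beta var beta L gamma -> lipschitz_differentiable L f ->
  z = gradient f u -> z' = gradient f u' -> z' = z + beta *: (x - y') ->
  (match var with Proximal => u = y /\ u' = y' | Gradient => u' = y end) ->
  local_potential f L beta x y' z' u'
  + (2 * (1 + L ^+ 2))^-1 * (enorm (y' - y) ^+ 2 + enorm (z' - z) ^+ 2)
  <= local_potential f L beta x y z u.
Proof.
move=> L0 hb lipf zE z'E z'z hu.
have L20 := sqr_ge0 L.
have b2 : 2 <= beta.
  by case: {+}var hb => /=; [|rewrite gt_max => /andP[_]]; lra.
have b0 : beta != 0 by rewrite gt_eqF//; lra.
have := local_lagrangian_update f y b0 z'z; rewrite /local_potential.
move: (local_lagrangian _ _ _ _ _) (local_lagrangian _ _ _ _ _) => A1 A2 AE.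
(* Chosen so that [k (1 + L^2) = 1 / 2], which fits into the slack left in either variant. *)
set k := (2 * (1 + L ^+ 2))^-1.
have k0 : 0 < k by rewrite invr_gt0; lra.
have kE : k + k * L ^+ 2 = 2^-1 by rewrite /k; field; lra.
have bV : beta^-1 <= 2^-1 by rewrite lef_pV2 ?posrE//; lra.
have bV0 : 0 < beta^-1 by rewrite invr_gt0; lra.
have ey := sqr_ge0 (enorm (y' - y)); have eu := sqr_ge0 (enorm (y - u)).
have zk a : enorm (z' - z) ^+ 2 <= L ^+ 2 * a ->
    (beta^-1 + k) * enorm (z' - z) ^+ 2 <= (beta^-1 + k) * (L ^+ 2 * a).
  by move=> h; rewrite ler_pM2l// addr_gt0.
have lip v w : enorm (gradient f v - gradient f w) ^+ 2 <= L ^+ 2 * enorm (v - w) ^+ 2.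
  rewrite -exprMn ler_sqr ?nnegrE ?enorm_ge0 ?mulr_ge0 ?enorm_ge0//.
  exact: lipf.2.
have bVL a : 0 <= a -> beta^-1 * (L ^+ 2 * a) <= 2^-1 * (L ^+ 2 * a).
  by move=> a0; rewrite ler_wpM2r// mulr_ge0.
have kEa a : k * a + k * (L ^+ 2 * a) = 2^-1 * a by rewrite -kE; ring.
case: var hb hu => /= [[_ hb] [uE u'E]|hb uE].
- rewrite {}uE in zE *; rewrite {}u'E in z'E *.
  rewrite !subrr enorm0 expr0n/= mulr0 !addr0.
  have := descent_lower y' y lipf; rewrite -z'E => h1.
  have := lip y' y; rewrite -z'E -zE => /zk h2.
  (* [L^2 / beta <= L / 2] since [2 L <= beta] *)
  have h3 : beta^-1 * (L ^+ 2 * enorm (y' - y) ^+ 2) <= L / 2 * enorm (y' - y) ^+ 2.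
    rewrite mulrA ler_wpM2r// mulrC ler_pdivrMr; last lra.
    by nra.
  have h4 := kEa (enorm (y' - y) ^+ 2).
  have h5 : (2 * L + 2) * enorm (y' - y) ^+ 2 <= beta * enorm (y' - y) ^+ 2.
    by rewrite ler_wpM2r.
  move: h1; rewrite -(opprB y' y) edotNr enormN.
  lra.
(* Half of [beta > 2 L^2 + L + 2] covers [L / 2] from the descent lemma, [(L^2 + 1) / 2] from the
   new correction term, and [k]. The old correction covers [L^2 / beta <= L^2 / 2] and [k L^2]. *)
- move: hb; rewrite gt_max => /andP[_ hb].
  rewrite {}uE in z'E *.
  have := descent_upper y y' lipf; rewrite -z'E => h1.
  have := lip y u; rewrite -z'E -zE => /zk h2.
  have h3 := bVL _ eu.
  have h4 := kEa (enorm (y - u) ^+ 2).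
  have h5 : (2 * L ^+ 2 + L + 2) * enorm (y' - y) ^+ 2 <= beta * enorm (y' - y) ^+ 2.
    by rewrite ler_wpM2r//; lra.
  have h6 : 0 <= L ^+ 2 * enorm (y' - y) ^+ 2 by rewrite mulr_ge0.
  have h7 : k * enorm (y' - y) ^+ 2 <= 2^-1 * enorm (y' - y) ^+ 2.
    by rewrite ler_wpM2r// -kE lerDl mulr_ge0// ltW.
  have h8 : 0 <= k * enorm (y - u) ^+ 2 by rewrite mulr_ge0// ltW.
  lra.
Qed.

End Lagrangian.

(** * Subgradients of the joint augmented Lagrangian *)

Section JointSubdifferential.
Variables (R : realType) (n p : nat) (f : 'I_n -> 'rV[R]_p -> R).
Variables (r : 'rV[R]_p -> \bar R) (beta L : R).
Hypotheses (n0 : (0 < n)%N) (b0 : 0 <= beta).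
Hypothesis lipf : forall i, lipschitz_differentiable L (f i).

(** The gradient of the smooth part in the three blocks, with a subgradient [d] of [r] added to the
    first. *)
Definition lagrangian_subgradient (d x : 'rV[R]_p) (y z : 'M[R]_(n, p)) :
    'M[R]_(1 + (n + n), p) :=
  stack (d + n%:R^-1 *: \sum_i (row i z + beta *: (x - row i y)))
    (\matrix_i (n%:R^-1 *: (gradient (f i) (row i y) - row i z
                            + beta *: (row i y - x))))
    (\matrix_i (n%:R^-1 *: (x - row i y))).

Lemma edot_suml (I : finType) (F : I -> 'rV[R]_p) v :
  edot (\sum_i F i) v = \sum_i edot (F i) v.
Proof.
by apply: (big_morph (fun u => edot u v)) => [a b|]; rewrite ?edotDl ?edot0l.
Qed.

Lemma rowB i (a b : 'M[R]_(n, p)) : row i (a - b) = row i a - row i b.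
Proof. exact: linearB. Qed.

Lemma ler_sum_minorant (P1 P2 P3 P4 P5 P6 P7 : 'I_n -> R) (a c : R) :
  (forall i, P1 i + P2 i + P3 i + P4 i - c * (a + P5 i + P6 i) <= P7 i) ->
  \sum_i P1 i + \sum_i P2 i + \sum_i P3 i + \sum_i P4 i
    - c * (n%:R * a + \sum_i P5 i + \sum_i P6 i) <= \sum_i P7 i.
Proof.
move=> h; apply: le_trans (ler_sum _ (fun i _ => h i)).
rewrite !big_split/= sumrN -mulr_sumr !big_split/= sumr_const card_ord.
by rewrite mulr_natl.
Qed.

(** The minorant of [r] plus the average of the local ones is a global quadratic minorant of the
    joint function. *)
Lemma lagrangian_subgradientP d x y z : r x \is a fin_num ->
  (forall v, (r x + (edot d (v - x) - beta / 2 * enorm (v - x) ^+ 2)%:E <= r v)%E) ->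
  subdifferential (aug_lagrangian_joint f r beta) (stack x y z)
    (lagrangian_subgradient d x y z).
Proof.
move=> rx rd.
(* The sign of [L] is not fixed here, and the quadratic constant has to be nonnegative. *)
pose A : R := `|L|; have A0 : 0 <= A := normr_ge0 L.
apply: (@quadratic_minorant_subdifferential _ _ _ _ _ _
  (beta / 2 + 1 + A / 2)) => [|w].
  rewrite /aug_lagrangian_joint /stack !(col_mxKu, col_mxKd).
  by rewrite fin_numD rx.
rewrite -(vsubmxK w) -(vsubmxK (dsubmx w)).
move: (usubmx w) (usubmx (dsubmx w)) (dsubmx (dsubmx w)) => {w} x' y' z'.
rewrite /aug_lagrangian_joint /stack !(col_mxKu, col_mxKd).
rewrite /lagrangian_subgradient /stack.
rewrite !opp_col_mx !add_col_mx !enorm_sq !edot_col_mx.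
have N0 : 0 < (n%:R : R) by rewrite ltr0n.
rewrite /aug_lagrangian; have := rd x'; rewrite -[r x]fineK//.
case: (r x') => [a||]; rewrite -?EFinD ?lee_fin ?leey//= => rle.
have minor i := local_lagrangian_minorant x (row i y) (row i z)
  x' (row i y') (row i z') (lipf i) A0 (ler_norm L) b0.
have := ler_sum_minorant minor.
rewrite (edot_rows (y' - y) (y' - y)) (edot_rows (z' - z) (z' - z)).
rewrite (edot_rows _ (y' - y)) (edot_rows _ (z' - z)).
rewrite edotDl edotZl edot_suml.
under [X in _ -> _ + _ + (_ + (X + _) - _) <= _]eq_bigr do rewrite rowK edotZl.
under [X in _ -> _ + _ + (_ + (_ + X) - _) <= _]eq_bigr do rewrite rowK edotZl.
rewrite -!mulr_sumr.
under [X in _ -> _ + _ + (_ - _ * (_ + (X + _))) <= _]eq_bigr do rewrite -enorm_sq rowB.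
under [X in _ -> _ + _ + (_ - _ * (_ + (_ + X))) <= _]eq_bigr do rewrite -enorm_sq rowB.
under [X in _ -> _ + _ + (_ + (_ * X + _) - _) <= _]eq_bigr do rewrite rowB.
under [X in _ -> _ + _ + (_ + (_ + _ * X) - _) <= _]eq_bigr do rewrite rowB.
rewrite -enorm_sq /local_lagrangian => minor_sum.
have := ler_wpM2l (ltW (_ : 0 < n%:R^-1)) minor_sum; rewrite invr_gt0 => /(_ N0).
have n1 : (n%:R^-1 : R) <= 1 by rewrite invf_le1// ler1n.
have nn : (n%:R^-1 : R) * n%:R = 1 by rewrite mulVf// gt_eqF.
move: minor_sum => _; move: rle nn n1 N0.
have : 0 <= \sum_(i < n) enorm (row i y' - row i y) ^+ 2 by apply: sumr_ge0 => i _; exact: sqr_ge0.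
have : 0 <= \sum_(i < n) enorm (row i z' - row i z) ^+ 2 by apply: sumr_ge0 => i _; exact: sqr_ge0.
move: (\sum_(i < n) enorm (row i y' - row i y) ^+ 2) => Sy.
move: (\sum_(i < n) enorm (row i z' - row i z) ^+ 2) => Sz.
move: (enorm (x' - x) ^+ 2) (n%:R : R) => ex N.
move: (N^-1) => v Sz0 Sy0 rle vN v1 N0.
(* The [x] term is common to the [n] agents, so averaging returns it exactly; the [y] and [z] terms
   are enlarged using [1 / n <= 1]. *)
have hA : (1 + A / 2) * (v * (Sy + Sz)) <= (1 + A / 2) * (Sy + Sz).
  by rewrite ler_wpM2l ?ler_piMl ?addr_ge0 ?divr_ge0.
have hb : 0 <= beta * (Sy + Sz) by rewrite mulr_ge0// addr_ge0.
have hN : (1 + A / 2) * (v * N * ex) = (1 + A / 2) * ex by rewrite vN mul1r.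
lra.
Qed.

End JointSubdifferential.

(** * Trajectories *)

Lemma sum_update (V : zmodType) (I : finType) (F F' : I -> V) (j : I) :
  (forall i, i != j -> F' i = F i) ->
  \sum_i F' i = \sum_i F i + (F' j - F j).
Proof.
move=> FF'; rewrite (bigD1 j)//= [in RHS](bigD1 j)//= (eq_bigr _ FF').
by rewrite [RHS]addrC -addrA addKr.
Qed.

Lemma sqr_sum_le (R : realType) (m : nat) (a : nat -> R) :
  (\sum_(i < m) a i) ^+ 2 <= m%:R * \sum_(i < m) a i ^+ 2.
Proof.
have [->|m0] := posnP m; first by rewrite !big_ord0 mulr0 expr0n.
pose u : 'rV[R]_m := \row_i a i; pose S := \sum_(i < m) a i.
have uS : edot u (const_mx 1) = S.
  by rewrite /edot big_ord1; apply: eq_bigr => i _; rewrite !mxE mulr1.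
have uu : edot u u = \sum_(i < m) a i ^+ 2.
  by rewrite /edot big_ord1; apply: eq_bigr => i _; rewrite !mxE expr2.
have oo : edot (const_mx 1 : 'rV[R]_m) (const_mx 1) = m%:R.
  rewrite /edot big_ord1 (eq_bigr (fun=> 1)) ?sumr_const ?card_ord//.
  by move=> i _; rewrite !mxE mulr1.
have := edot_ge0 (m%:R *: u - S *: const_mx 1).
rewrite !edotE uS uu oo edotC uS -/S.
move=> h; have N0 : 0 < (m%:R : R) by rewrite ltr0n.
by rewrite -(ler_pM2l N0); lra.
Qed.

Section Trajectory.
Variables (R : realType) (n p : nat) (var : variant) (beta L gamma flow : R).
Variables (f : 'I_n -> 'rV[R]_p -> R) (r : 'rV[R]_p -> \bar R) (j : nat -> 'I_n).
Variables (x0 : 'rV[R]_p) (y0 z0 : 'M[R]_(n, p)).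
Variables (x xbar : nat -> 'rV[R]_p) (y z : nat -> 'M[R]_(n, p)).
Hypothesis rNy : forall u, r u != -oo%E.
Hypothesis L0 : 0 <= L.
Hypothesis beta0 : 0 < beta.
Hypothesis hbeta : admissible_beta var beta L gamma.
Hypothesis lipf : forall i, lipschitz_differentiable L (f i).
Hypothesis rcvx : semiconvex gamma r.
Hypothesis flow_le : forall u, (flow%:E <= objective f r u)%E.
Hypothesis y0z0 : forall i, gradient (f i) (row i y0) = row i z0.
Hypothesis traj : walkman var beta f r (fun k (_ : unit) => j k) x0 y0 z0
  (fun k _ => x k) (fun k _ => xbar k) (fun k _ => y k) (fun k _ => z k).

Lemma admissible_gt : [/\ gamma < beta, L < beta, L + 1 <= beta & 1 <= beta].
Proof.
have L1 := L0; have L20 := sqr_ge0 L.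
case: var hbeta => /= [[? ?]|]; first by split; lra.
by rewrite gt_max => /andP[? ?]; split; lra.
Qed.

Lemma agents_gt0 : (0 < n)%N.
Proof. by rewrite (leq_trans _ (ltn_ord (j 0))). Qed.

Let n0 : 0 < (n%:R : R).
Proof. by rewrite ltr0n agents_gt0. Qed.

Lemma x_prox k : prox beta^-1 r (xbar k.+1) (x k.+1).
Proof. by have [_ _ _ _ /(_ k)[]] := traj tt. Qed.

Lemma row_y_idle k i : i != j k -> row i (y k.+1) = row i (y k).
Proof. by have [_ _ _ _ /(_ k)[_ [_ h] _ _ _]] := traj tt; exact: h. Qed.

Lemma row_z_idle k i : i != j k -> row i (z k.+1) = row i (z k).
Proof. by have [_ _ _ _ /(_ k)[_ _ _ h _]] := traj tt; exact: h. Qed.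

Lemma row_z_visit k : row (j k) (z k.+1) =
  row (j k) (z k) + beta *: (x k.+1 - row (j k) (y k.+1)).
Proof. by have [_ _ _ _ /(_ k)[]] := traj tt. Qed.

Lemma row_y_visit k : y_update var beta (f (j k)) (x k.+1)
  (row (j k) (y k)) (row (j k) (z k)) (row (j k) (y k.+1)).
Proof. by have [_ _ _ _ /(_ k)[_ []]] := traj tt. Qed.

(** Only the visited agent changes [y_i - z_i / beta], so the incremental recursion maintains the
    full average. *)
Lemma xbarE k : xbar k.+1 =
  n%:R^-1 *: \sum_i (row i (y k) - beta^-1 *: row i (z k)).
Proof.
have [_ yE zE xb1 H] := traj tt.
elim: k => [|k IH]; first by rewrite yE zE.
have [_ _ _ _ ->] := H k; rewrite IH -addrA -scalerBr -scalerDr; congr (_ *: _).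
pose s l i : 'rV[R]_p := row i (y l) - beta^-1 *: row i (z l).
rewrite -/(s k _) -/(s k.+1 _) [RHS](@sum_update _ _ (s k) _ (j k)) ?addrA//.
by move=> i ij; rewrite /s row_y_idle// row_z_idle.
Qed.

Lemma x_fin k : r (x k.+1) \is a fin_num.
Proof. exact: prox_fin rNy (x_prox k). Qed.

(* The point at which the dual variable [z i] is the gradient of [f i]. *)
Fixpoint dual_point (k : nat) : 'M[R]_(n, p) :=
  match k with
  | 0 => y0
  | k'.+1 => \matrix_i (if i == j k' then
               match var with
               | Proximal => row i (y k'.+1) | Gradient => row i (y k')
               end
             else row i (dual_point k'))
  end.

Lemma dual_point_idle k i : i != j k ->
  row i (dual_point k.+1) = row i (dual_point k).
Proof. by move=> ij; rewrite /= rowK (negPf ij). Qed.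

(** Stationarity of the proximal step, or the very formula of the gradient step, says that the dual
    update lands on a gradient; the initialization starts the induction. *)
Lemma row_zE k i : row i (z k) = gradient (f i) (row i (dual_point k)).
Proof.
elim: k => [|k IH]; first by have [_ _ -> _ _] := traj tt; rewrite y0z0.
have [->|ij] := eqVneq i (j k); last by rewrite row_z_idle// dual_point_idle.
rewrite /= rowK eqxx row_z_visit; have := row_y_visit k; rewrite /y_update.
have [_ Lb _ _] := admissible_gt.
have bV : beta != 0 by rewrite gt_eqF.
case: var => [h|->].
  rewrite (prox_smooth_stationary (lipf (j k)) beta0 _ h) ?ltr_wpDl//.
  by apply/matrixP => a b; rewrite !mxE; field.
by apply/matrixP => a b; rewrite !mxE; field.
Qed.

Lemma dual_point_prox k : var = Proximal -> dual_point k = y k.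
Proof.
move=> vE; elim: k => [|k IH]; first by have [_ -> _ _ _] := traj tt.
apply/row_matrixP => i; rewrite /= rowK vE.
by case: eqVneq => // ij; rewrite IH row_y_idle.
Qed.

Lemma dual_point_visit k :
  match var with
  | Proximal => row (j k) (dual_point k) = row (j k) (y k)
                /\ row (j k) (dual_point k.+1) = row (j k) (y k.+1)
  | Gradient => row (j k) (dual_point k.+1) = row (j k) (y k)
  end.
Proof.
case vE: var; last by rewrite /= rowK eqxx vE.
by rewrite !dual_point_prox.
Qed.

(** * The Lyapunov function and the summability of the increments *)

Definition potential k : R := fine (r (x k)) + n%:R^-1 *
  \sum_i local_potential (f i) L beta (x k) (row i (y k)) (row i (z k))
           (row i (dual_point k)).

Definition increment k : R := enorm (x k.+1 - x k) ^+ 2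
  + enorm (y k.+1 - y k) ^+ 2 + enorm (z k.+1 - z k) ^+ 2.

Lemma increment_ge0 k : 0 <= increment k.
Proof. by rewrite !addr_ge0// sqr_ge0. Qed.

Lemma enorm_sq_row1 (a b : 'M[R]_(n, p)) (i0 : 'I_n) :
  (forall i, i != i0 -> row i a = row i b) ->
  enorm (a - b) ^+ 2 = enorm (row i0 a - row i0 b) ^+ 2.
Proof.
move=> ab; rewrite enorm_sq_rows (bigD1 i0)//= big1 ?addr0 ?rowB// => i ii0.
by rewrite rowB ab// subrr enorm0 expr0n.
Qed.

Lemma potential_0 : r x0 \is a fin_num ->
  aug_lagrangian f r beta x0 y0 z0 = (potential 0)%:E.
Proof.
move=> rx0; have [x0E y0E z0E _ _] := traj tt.
rewrite /potential x0E y0E z0E EFinD fineK//; congr (_ + (_ * _)%:E)%E.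
by apply: eq_bigr => i _; rewrite /local_potential subrr enorm0 expr0n mulr0 addr0.
Qed.

Lemma potential_ge k : r (x k) \is a fin_num -> flow <= potential k.
Proof.
move=> rx; rewrite -lee_fin; apply: le_trans (flow_le (x k)) _.
rewrite /objective /potential EFinD fineK// leeD2l// lee_fin.
rewrite ler_pM2l ?invr_gt0//; apply: ler_sum => i _.
by rewrite row_zE; apply: local_potential_ge => //; have [] := admissible_gt.
Qed.

Lemma potential_x_decrease k : r (x k) \is a fin_num ->
  fine (r (x k.+1)) + n%:R^-1 *
  \sum_i local_potential (f i) L beta (x k.+1) (row i (y k)) (row i (z k))
           (row i (dual_point k)) + (beta - gamma) / 2 * enorm (x k.+1 - x k) ^+ 2
  <= potential k.
Proof.
move=> rx; have := prox_strong rNy beta0 rcvx (x_prox k) rx.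
rewrite (enormB (x k)) /potential.
set S1 := \sum_i _; set S2 := \sum_i _.
(* With [y] and [z] frozen, the average of the local terms is [beta / 2 |x - xbar|^2] up to a
   constant, so the [x]-update minimizes the whole potential in [x]. *)
suff : n%:R^-1 * (S2 - S1) = beta / 2 * enorm (x k - xbar k.+1) ^+ 2
    - beta / 2 * enorm (x k.+1 - xbar k.+1) ^+ 2 by lra.
rewrite -sumrB.
under eq_bigr => i _.
  rewrite (_ : _ - _ = beta / 2 * (enorm (x k) ^+ 2 - enorm (x k.+1) ^+ 2)
    - beta * edot (row i (y k) - beta^-1 *: row i (z k)) (x k - x k.+1)); last first.
    rewrite /local_potential /local_lagrangian !enorm_sq !edotE.
    rewrite (edotC (x k) (row i (y k))) (edotC (x k.+1) (row i (y k))).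
    by field; rewrite gt_eqF.
  over.
rewrite sumrB sumr_const card_ord -mulr_sumr -edot_suml mulrBr -[(_ * _) *+ n]mulr_natl.
rewrite (mulrA _ n%:R) mulVf ?gt_eqF// mul1r (mulrCA _ beta) -edotZl -xbarE.
rewrite !enorm_sq !edotE (edotC (x k) (xbar _)) (edotC (x k.+1) (xbar _)); lra.
Qed.

(** After the [x]-update only the summand of the visited agent changes, and the squared increments
    of [y] and [z] reduce to its rows. *)
Lemma potential_decrease k : r (x k) \is a fin_num ->
  potential k.+1 + (beta - gamma) / 2 * enorm (x k.+1 - x k) ^+ 2
  + n%:R^-1 * ((2 * (1 + L ^+ 2))^-1 *
               (enorm (y k.+1 - y k) ^+ 2 + enorm (z k.+1 - z k) ^+ 2))
  <= potential k.
Proof.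
move=> rx; apply: le_trans (potential_x_decrease rx).
rewrite /potential (@sum_update _ _ (fun i => local_potential (f i) L beta
  (x k.+1) (row i (y k)) (row i (z k)) (row i (dual_point k))) _ (j k)); last first.
  by move=> i ij; rewrite row_y_idle// row_z_idle// dual_point_idle.
have := local_potential_decrease L0 hbeta (lipf (j k)) (row_zE k _)
  (row_zE k.+1 _) (row_z_visit k) (dual_point_visit k).
rewrite !(enorm_sq_row1 (i0 := j k)); last 2 first.
- by move=> i ij; rewrite row_z_idle.
- by move=> i ij; rewrite row_y_idle.
have : 0 < (n%:R^-1 : R) by rewrite invr_gt0.
move: (n%:R^-1 : R) => v v0 h.
have := ler_wpM2l (ltW v0) h; lra.
Qed.

(* The increments of [y] and [z] enter with weight [1 / n], hence the factor [n]. *)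
Lemma increment_sum N : r x0 \is a fin_num ->
  \sum_(k < N) increment k <= n%:R * (potential 0 - flow)
    * (2 / (beta - gamma) + 2 * (1 + L ^+ 2)).
Proof.
move=> rx0; have [gb _ _ _] := admissible_gt.
have rx k : r (x k) \is a fin_num.
  by case: k => [|k]; [have [-> _ _ _ _] := traj tt|exact: x_fin].
have tele : potential N + \sum_(k < N) ((beta - gamma) / 2 * enorm (x k.+1 - x k) ^+ 2
  + n%:R^-1 * ((2 * (1 + L ^+ 2))^-1 *
               (enorm (y k.+1 - y k) ^+ 2 + enorm (z k.+1 - z k) ^+ 2)))
  <= potential 0.
  elim: N => [|N IH]; first by rewrite big_ord0 addr0.
  by rewrite big_ord_recr/=; have := potential_decrease (rx N); lra.
have := potential_ge (rx N); move: tele.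
rewrite /increment; under [X in _ -> _ -> X <= _]eq_bigr do rewrite -addrA.
rewrite !big_split/= -!mulr_sumr !big_split/=.
have : 0 <= \sum_(k < N) enorm (x k.+1 - x k) ^+ 2.
  by apply: sumr_ge0 => i _; exact: sqr_ge0.
have : 0 <= \sum_(k < N) enorm (y k.+1 - y k) ^+ 2 + \sum_(k < N) enorm (z k.+1 - z k) ^+ 2.
  by apply: addr_ge0; apply: sumr_ge0 => i _; exact: sqr_ge0.
move: (\sum_(k < N) enorm (x k.+1 - x k) ^+ 2) => Sx.
move: (\sum_(k < N) enorm (y k.+1 - y k) ^+ 2 + _) => Syz.
have n1 : 1 <= (n%:R : R) by rewrite ler1n agents_gt0.
have L20 := sqr_ge0 L.
have K0 : 0 < 2 * (1 + L ^+ 2) by lra.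
have B0 : 0 < beta - gamma by lra.
move: (n%:R : R) n0 n1 (2 * (1 + L ^+ 2)) K0 (beta - gamma) B0 (potential 0) (potential N).
move=> v v0 v1 K K0 B B0 P0 PN Syz0 Sx0 tele PNf.
have D0 : 0 <= P0 - flow.
  have : 0 <= B / 2 * Sx by rewrite mulr_ge0// divr_ge0// ltW.
  have : 0 <= v^-1 * (K^-1 * Syz) by rewrite !mulr_ge0// invr_ge0 ltW.
  lra.
have hx : Sx <= (P0 - flow) * (2 / B).
  rewrite mulrA ler_pdivlMr//.
  have : 0 <= v^-1 * (K^-1 * Syz) by rewrite !mulr_ge0// invr_ge0 ltW.
  lra.
have hyz : Syz <= v * (P0 - flow) * K.
  have h : v^-1 * (K^-1 * Syz) <= P0 - flow.
    have : 0 <= B / 2 * Sx by rewrite mulr_ge0// divr_ge0// ltW.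
    lra.
  have := ler_wpM2l (ltW (mulr_gt0 v0 K0)) h.
  by rewrite (_ : v * K * _ = Syz) 1?mulrAC//; field; rewrite !gt_eqF.
(* The bound on [x] is weakened by the factor [n >= 1] to match the one on [y] and [z]. *)
have : (P0 - flow) * (2 / B) <= v * ((P0 - flow) * (2 / B)).
  by rewrite ler_peMl// mulr_ge0// divr_ge0// ltW.
lra.
Qed.

(** Lack of consensus plus lack of dual accuracy: together they control the rows of agent [i] in the
    [y] and [z] blocks of the subgradient. *)
Definition residual i k : R := enorm (x k - row i (y k))
  + enorm (gradient (f i) (row i (y k)) - row i (z k)).

Definition drift k : R := enorm (x k.+1 - x k) + enorm (y k.+1 - y k)
  + enorm (z k.+1 - z k).

Lemma residual_ge0 i k : 0 <= residual i k.
Proof. by rewrite addr_ge0 ?enorm_ge0. Qed.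

Lemma drift_ge0 k : 0 <= drift k.
Proof. by rewrite !addr_ge0 ?enorm_ge0. Qed.

Lemma drift_sq k : drift k ^+ 2 <= 3 * increment k.
Proof.
rewrite /drift /increment.
move: (enorm _) (enorm _) (enorm _) => a b c.
have := sqr_ge0 (a - b); have := sqr_ge0 (a - c); have := sqr_ge0 (b - c); lra.
Qed.

(** The triangle inequality, read backward in time: the present residual is bounded by the next one,
    as looking ahead requires. *)
Lemma residual_step i k : residual i k <= residual i k.+1 + (1 + L) * drift k.
Proof.
have L1 := L0; rewrite /residual.
have -> : x k - row i (y k) = (x k.+1 - row i (y k.+1)) + (row i (y k.+1 - y k) + - (x k.+1 - x k)).
  by apply/matrixP => a b; rewrite !mxE; ring.
set G := gradient (f i); set G' := G (row i (y k.+1)).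
have -> : G (row i (y k)) - row i (z k) = (G' - row i (z k.+1))
    + ((G (row i (y k)) - G') + row i (z k.+1 - z k)).
  by apply/matrixP => a b; rewrite !mxE; ring.
have hG : enorm (G (row i (y k)) - G') <= L * enorm (row i (y k.+1 - y k)).
  by rewrite rowB (enormB (row i (y k.+1))); exact: (lipf i).2.
have := enormD (x k.+1 - row i (y k.+1)) (row i (y k.+1 - y k) + - (x k.+1 - x k)).
have := enormD (row i (y k.+1 - y k)) (- (x k.+1 - x k)); rewrite enormN.
have := enormD (G' - row i (z k.+1)) ((G (row i (y k)) - G') + row i (z k.+1 - z k)).
have := enormD (G (row i (y k)) - G') (row i (z k.+1 - z k)).
have hy := enorm_row (y k.+1 - y k) i; have hz := enorm_row (z k.+1 - z k) i.
rewrite /drift.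
have hLy := ler_wpM2l L0 hy.
have hLx := mulr_ge0 L0 (enorm_ge0 (x k.+1 - x k)).
have hLz := mulr_ge0 L0 (enorm_ge0 (z k.+1 - z k)).
lra.
Qed.

(** After the visit, [x - y'] is [(z' - z) / beta] with [beta >= 1]. The gradient at [y'] differs
    from the dual variable by 0 in the proximal variant and by at most [L |y' - y|] in the gradient
    one. *)
Lemma residual_visit k : residual (j k) k.+1 <= (1 + L) * drift k.
Proof.
have [_ _ _ b1] := admissible_gt.
have hz := enorm_row (z k.+1 - z k) (j k).
have hy := enorm_row (y k.+1 - y k) (j k).
have hLy := ler_wpM2l L0 hy.
have hLx := mulr_ge0 L0 (enorm_ge0 (x k.+1 - x k)).
have hLz := mulr_ge0 L0 (enorm_ge0 (z k.+1 - z k)).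
have h1 : enorm (x k.+1 - row (j k) (y k.+1)) <= enorm (z k.+1 - z k).
  apply: le_trans hz; rewrite rowB row_z_visit addrAC subrr add0r enormZ.
  by rewrite ger0_norm ?(ltW beta0)// ler_peMl ?enorm_ge0.
have h2 : enorm (gradient (f (j k)) (row (j k) (y k.+1)) - row (j k) (z k.+1))
    <= L * enorm (y k.+1 - y k).
  apply: le_trans hLy; rewrite rowB row_zE.
  have := dual_point_visit k; case: var => [[_ ->]|->]; last exact: (lipf _).2.
  by rewrite subrr enorm0 mulr_ge0 ?enorm_ge0.
have := enorm_ge0 (x k.+1 - x k); have := enorm_ge0 (y k.+1 - y k).
by rewrite /residual /drift; lra.
Qed.

(** Telescopes from [k + 1] to [k + t + 1], right after the visit at [k + t]. For [t > 0] the drift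
    at [k + t] is counted twice, once in the sum and once for the visit. *)
Lemma residual_forward k t : residual (j (k + t)) k.+1 <=
  (1 + L) * (\sum_(s < t) drift (k.+1 + s) + drift (k + t)).
Proof.
have tele i m : residual i m <= residual i (m + t) + (1 + L) * \sum_(s < t) drift (m + s).
  elim: t => [|t IH]; first by rewrite big_ord0 mulr0 addr0 addn0.
  rewrite big_ord_recr/= addnS; have := residual_step i (m + t); lra.
by have := tele (j (k + t)) k.+1; have := residual_visit (k + t); rewrite addSn; lra.
Qed.

Lemma residual_forward_sq k t : residual (j (k + t)) k.+1 ^+ 2 <=
  3 * (1 + L) ^+ 2 * t.+1%:R
  * (\sum_(s < t) increment (k.+1 + s) + increment (k + t)).
Proof.
have L1 : 0 <= 1 + L by rewrite addr_ge0.
(* Merges the sum and the extra term into one sum of [t + 1] terms, to which [sqr_sum_le]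
   applies. *)
pose a s := if (s < t)%N then drift (k.+1 + s) else drift (k + t).
have aE (F : R -> R) : \sum_(s < t) F (drift (k.+1 + s)) + F (drift (k + t))
    = \sum_(s < t.+1) F (a s).
  rewrite big_ord_recr /a/= ltnn; congr (_ + _).
  by apply: eq_bigr => s _; rewrite ltn_ord.
have h := residual_forward k t; rewrite (aE id) in h.
have S0 : 0 <= \sum_(s < t.+1) a s.
  by apply: sumr_ge0 => s _; rewrite /a; case: ifP => _; exact: drift_ge0.
have : residual (j (k + t)) k.+1 ^+ 2 <= ((1 + L) * \sum_(s < t.+1) a s) ^+ 2.
  by rewrite ler_sqr ?nnegrE ?residual_ge0 ?mulr_ge0.
move=> /le_trans; apply; rewrite exprMn.
set Q := (\sum_(s < t) _ + _).
rewrite (_ : 3 * _ * _ * _ = (1 + L) ^+ 2 * (3 * (t.+1%:R * Q))); last by ring.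
rewrite ler_wpM2l ?sqr_ge0//.
apply: le_trans (sqr_sum_le t.+1 a) _.
rewrite mulrCA ler_wpM2l// -(aE (fun b => b ^+ 2)) mulrDr mulr_sumr.
by rewrite lerD ?drift_sq//; apply: ler_sum => s _; exact: drift_sq.
Qed.

(** The slope used for [r] is the one given by optimality of the proximal [x]-update. *)
Definition walkman_subgradient k : 'M[R]_(1 + (n + n), p) :=
  lagrangian_subgradient f beta (beta *: (xbar k.+1 - x k.+1))
    (x k.+1) (y k.+1) (z k.+1).

Lemma walkman_subgradientP k : subdifferential (aug_lagrangian_joint f r beta)
  (stack (x k.+1) (y k.+1) (z k.+1)) (walkman_subgradient k).
Proof.
apply: (lagrangian_subgradientP agents_gt0 (ltW beta0) lipf) => [|v].
  exact: x_fin.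
exact: prox_subgradient beta0 (x_fin k) (x_prox k).
Qed.

(** The two contributions combine to [beta (xbar k.+1 - xbar k.+2)], where only the visited agent
    remains. *)
Lemma walkman_subgradient_x k :
  beta *: (xbar k.+1 - x k.+1)
  + n%:R^-1 *: \sum_i (row i (z k.+1) + beta *: (x k.+1 - row i (y k.+1)))
  = n%:R^-1 *: (row (j k) (z k.+1 - z k) - beta *: row (j k) (y k.+1 - y k)).
Proof.
have bV : beta != 0 by rewrite gt_eqF.
have -> : \sum_i (row i (z k.+1) + beta *: (x k.+1 - row i (y k.+1)))
    = n%:R *: (beta *: (x k.+1 - xbar k.+2)).
  rewrite xbarE; under eq_bigr => i _.
    rewrite (_ : _ + _ = beta *: x k.+1
      - beta *: (row i (y k.+1) - beta^-1 *: row i (z k.+1))); last first.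
      by apply/matrixP => a b; rewrite !mxE; field.
    over.
  rewrite sumrB sumr_const card_ord -scaler_sumr -scaler_nat.
  by apply/matrixP => a b; rewrite !mxE; field; rewrite gt_eqF.
rewrite (scalerA n%:R^-1) mulVf ?gt_eqF// scale1r.
have [_ _ _ _ /(_ k)[_ _ _ _ ->]] := traj tt.
by rewrite !rowB; apply/matrixP => a b; rewrite !mxE; field; rewrite bV gt_eqF.
Qed.

(** Multiplying by [n^2] clears the factor [1 / n] of all blocks. The [x] block is an increment of
    the visited agent, and the rows of agent [i] in the [y] and [z] blocks are at most [1 + beta]
    and 1 times its residual. *)
Lemma walkman_subgradient_norm k :
  n%:R ^+ 2 * enorm (walkman_subgradient k) ^+ 2
  <= 2 * (1 + beta ^+ 2) * increment k
     + ((1 + beta) ^+ 2 + 1) * \sum_i residual i k.+1 ^+ 2.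
Proof.
rewrite enorm_sq /walkman_subgradient /lagrangian_subgradient /stack !edot_col_mx.
rewrite walkman_subgradient_x.
have rows (F : 'I_n -> 'rV[R]_p) :
    edot (\matrix_i F i) (\matrix_i F i) = \sum_i edot (F i) (F i).
  by rewrite edot_rows; apply: eq_bigr => i _; rewrite rowK.
rewrite !rows -big_split/= mulrDr.
have scaled (v : 'rV[R]_p) :
    n%:R ^+ 2 * edot (n%:R^-1 *: v) (n%:R^-1 *: v) = enorm v ^+ 2.
  rewrite -enorm_sq enormZ exprMn ger0_norm ?invr_ge0// mulrA -exprMn.
  by rewrite mulfV ?gt_eqF// expr1n mul1r.
rewrite scaled; apply: lerD; last first.
  rewrite [X in X <= _]mulr_sumr [X in _ <= X]mulr_sumr.
  apply: ler_sum => i _; rewrite mulrDr !scaled mulrDl mul1r; apply: lerD.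
    rewrite -exprMn ler_sqr ?nnegrE ?enorm_ge0//; last first.
      by rewrite mulr_ge0 ?residual_ge0// addr_ge0// ltW.
    apply: le_trans (enormD _ _) _; rewrite enormZ (ger0_norm (ltW beta0)).
    rewrite (enormB (row i (y k.+1))) /residual.
    have h1 := enorm_ge0 (gradient (f i) (row i (y k.+1)) - row i (z k.+1)).
    have h2 := enorm_ge0 (x k.+1 - row i (y k.+1)).
    by have := mulr_ge0 (ltW beta0) h1; lra.
  rewrite ler_sqr ?nnegrE ?enorm_ge0 ?residual_ge0//.
  by rewrite /residual lerDl enorm_ge0.
apply: le_trans (enormD_sq _ _) _.
rewrite enormN enormZ (ger0_norm (ltW beta0)) exprMn -mulrA ler_pM2l//.
have hy := enorm_row (y k.+1 - y k) (j k).
have hz := enorm_row (z k.+1 - z k) (j k).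
rewrite -ler_sqr ?nnegrE ?enorm_ge0// in hy; rewrite -ler_sqr ?nnegrE ?enorm_ge0// in hz.
have hb := ler_wpM2l (sqr_ge0 beta) hy.
rewrite /increment; have := sqr_ge0 (enorm (x k.+1 - x k)).
have := mulr_ge0 (sqr_ge0 beta) (sqr_ge0 (enorm (x k.+1 - x k))).
have := mulr_ge0 (sqr_ge0 beta) (sqr_ge0 (enorm (z k.+1 - z k))).
have := sqr_ge0 (enorm (y k.+1 - y k)).
lra.
Qed.

End Trajectory.

(** * Markov chains *)

(** Measurability with respect to the walk up to time [k] inclusive, encoded as functional
    dependence. There are finitely many histories, so for real-valued functions of a Markov chain it
    yields measurability and integrability. *)
Definition adapted (S T : Type) (n : nat) (ik : nat -> T -> 'I_n) (k : nat)
    (X : T -> S) : Prop :=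
  forall w w', (forall t, (t <= k)%N -> ik t w = ik t w') -> X w = X w'.

Lemma probability_inhabited (R : realType) (d : measure_display)
  (T : measurableType d) (Pr : probability T R) : exists w : T, True.
Proof.
apply: contrapT => h; have := probability_setT Pr.
rewrite (_ : [set: T] = set0) ?measure0; last by apply/seteqP; split=> // w; case: h; exists w.
by move=> /eqP; rewrite eqe eq_sym oner_eq0.
Qed.

Section Chain.
Variables (R : realType) (d : measure_display) (T : measurableType d).
Variables (Pr : probability T R) (n : nat) (ik : nat -> T -> 'I_n).
Variables (P : 'M[R]_n).
Hypothesis mc : markov_chain Pr ik P.

Let prob (A : set T) : R := fine (Pr A).

Lemma measurable_visit k j : measurable [set w | ik k w = j].
Proof. by have [h _ _] := mc; exact: h. Qed.

Lemma measurable_follows_path a k : measurable (follows_path ik a k).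
Proof.
elim: k => [|k IH].
  rewrite (_ : follows_path _ _ _ = [set w | ik 0 w = a 0]); first exact: measurable_visit.
  by apply/seteqP; split=> [w|w w0 t]; [exact|rewrite leqn0 => /eqP ->].
rewrite (_ : follows_path _ _ _ = follows_path ik a k `&` [set w | ik k.+1 w = a k.+1]).
  by apply: measurableI => //; exact: measurable_visit.
apply/seteqP; split=> [w h|w [h hk] t].
  by split=> [t tk|]; apply: h => //; exact: leqW.
by rewrite leq_eqVlt => /orP[/eqP ->//|]; exact: h.
Qed.

Definition history k (w : T) : {ffun 'I_k.+1 -> 'I_n} := [ffun i => ik (val i) w].

Lemma history_eq k w w' : history k w = history k w' ->
  forall t, (t <= k)%N -> ik t w = ik t w'.
Proof.
move=> /ffunP h t tk; have := h (Ordinal (tk : (t < k.+1)%N)).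
by rewrite !ffunE.
Qed.

Definition extend_history k (a : {ffun 'I_k.+1 -> 'I_n}) t : 'I_n := a (inord t).

Definition cylinder k (a : {ffun 'I_k.+1 -> 'I_n}) : set T :=
  follows_path ik (extend_history a) k.

Lemma cylinderE k (a : {ffun 'I_k.+1 -> 'I_n}) w : cylinder a w <-> history k w = a.
Proof.
split=> [h|<- t tk]; last by rewrite /extend_history ffunE /= inordK.
apply/ffunP => i; rewrite ffunE h /extend_history ?inord_val//.
by rewrite -ltnS; exact: ltn_ord.
Qed.

Lemma measurable_cylinder k (a : {ffun 'I_k.+1 -> 'I_n}) : measurable (cylinder a).
Proof. exact: measurable_follows_path. Qed.

Lemma adapted_factor (S : Type) k (X : T -> S) : adapted ik k X ->
  exists c : {ffun 'I_k.+1 -> 'I_n} -> S, forall w, X w = c (history k w).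
Proof.
move=> aX; have [w0 _] := probability_inhabited Pr.
(* The value of [X] at a representative of the cylinder; an empty cylinder gets the value at
   [w0]. *)
exists (fun a => X (xget w0 (cylinder a))) => w; apply: aX.
have /cylinderE : cylinder (history k w) (xget w0 (cylinder (history k w))).
  by apply: (@xgetI _ w0 _ w); exact/cylinderE.
by move/esym/history_eq.
Qed.

Lemma adapted_measurable k (X : T -> R) : adapted ik k X -> measurable_fun setT X.
Proof.
move=> /adapted_factor [c cE] _ B mB; rewrite setTI.
rewrite (_ : _ @^-1` _ = \bigcup_(a in [set a | B (c a)]) cylinder a).
  by apply: fin_bigcup_measurable => // a _; exact: measurable_cylinder.
apply/seteqP; split=> [w Bw|w [a Ba] /cylinderE wa].
  by exists (history k w); [rewrite /= -cE|apply/cylinderE].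
by rewrite /= cE wa.
Qed.

Lemma adapted_integrable k (X : T -> R) : adapted ik k X ->
  Pr.-integrable setT (EFin \o X).
Proof.
move=> aX; apply: measurable_bounded_integrable => //.
- by rewrite -ge0_fin_numE// fin_num_measure.
- exact: adapted_measurable aX.
have [c cE] := adapted_factor aX.
exists (\sum_a `|c a|); split; first exact: num_real.
move=> M hM w _ /=; rewrite cE; apply: le_trans (ltW hM).
by rewrite (bigD1 (history k w))//= lerDl sumr_ge0.
Qed.

Lemma Rintegral_indic_sum (I : finType) (c : I -> R) (A : I -> set T) :
  (forall i, measurable (A i)) ->
  \int[Pr]_w (\sum_i c i * \1_(A i) w) = \sum_i c i * prob (A i).
Proof.
move=> mA; rewrite /Rintegral.
under eq_integral do rewrite -sumEFin.
rewrite integral_sum//; last first.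
  move=> i; under eq_fun do rewrite EFinM.
  exact/integrableZl/integrable_indic.
under eq_bigr => i _.
  under eq_integral do rewrite EFinM.
  rewrite integralZl//; last exact: integrable_indic.
  rewrite integral_indic// setIT -[X in (_ * X)%E]fineK ?fin_num_measure//.
  rewrite -EFinM.
  over.
by rewrite sumEFin.
Qed.

Lemma prob_split (A : set T) k : measurable A ->
  prob A = \sum_c prob (A `&` [set w | ik k w = c]).
Proof.
move=> mA.
have h1 := @Rintegral_indic_sum 'I_1 (fun=> 1) (fun=> A) (fun=> mA).
rewrite big_ord1 mul1r in h1; rewrite -h1.
have h2 := @Rintegral_indic_sum 'I_n (fun=> 1) (fun c => A `&` [set w | ik k w = c])
  (fun c => measurableI _ _ mA (measurable_visit k c)).
transitivity (\sum_c 1 * prob (A `&` [set w | ik k w = c])); last first.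
  by apply: eq_bigr => c _; rewrite mul1r.
rewrite -h2; apply: eq_Rintegral => w _.
rewrite big_ord1 (bigD1 (ik k w))//= big1 => [|c cw]; rewrite !mul1r ?addr0 !indicE.
  by rewrite in_setI [X in _ && X]mem_set ?andbT.
by rewrite memNset// => -[_ /= wc]; rewrite wc eqxx in cw.
Qed.

(** The multi-step Markov property. Splitting over the position at [k + 1] reduces it to the path
    prolonged by one step, so [a] and [k] vary in the induction. *)
Lemma markov_forward a k t b :
  prob (follows_path ik a k `&` [set w | ik (k + t) w = b])
  = prob (follows_path ik a k) * (P ^+ t) (a k) b.
Proof.
have [_ _ step] := mc.
elim: t a k => [|t IH] a k.
  rewrite addn0 expr0; have [<-|ab] := eqVneq (a k) b.
    rewrite (_ : (1 : 'M[R]_n) _ _ = 1); last by rewrite mxE eqxx.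
    by rewrite mulr1 setIidl// => w /(_ k (leqnn k)).
  rewrite (_ : (1 : 'M[R]_n) _ _ = 0); last by rewrite mxE (negPf ab).
  rewrite mulr0 (_ : _ `&` _ = set0) /prob ?measure0//.
  apply/seteqP; split=> // w [/(_ k (leqnn k)) /= -> /= h].
  by rewrite h eqxx in ab.
pose ac c s := if s == k.+1 then c else a s.
have acE c : follows_path ik (ac c) k = follows_path ik a k.
  apply/seteqP; split=> w h s sk; rewrite h// /ac ltn_eqF//.
have acS c : follows_path ik (ac c) k.+1
    = follows_path ik a k `&` [set w | ik k.+1 w = c].
  apply/seteqP; split=> [w h|w [h hc] s].
    split=> [s sk|/=]; last by rewrite h// /ac eqxx.
    by rewrite h ?leqW// /ac ltn_eqF.
  rewrite leq_eqVlt => /orP[/eqP -> //|sk]; first by rewrite /ac eqxx.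
  by rewrite h// /ac ltn_eqF.
rewrite (prob_split k.+1); last first.
  by apply: measurableI; [exact: measurable_follows_path|exact: measurable_visit].
rewrite exprS mxE mulr_sumr; apply: eq_bigr => c _.
rewrite setIAC -acS addnS -addSn IH {2}/ac eqxx mulrA; congr (_ * _).
rewrite /prob step acE fineM ?fin_num_measure//; last exact: measurable_follows_path.
by rewrite /ac eqxx ltn_eqF.
Qed.

(** Given any history up to [k], each agent is visited at time [k + t] with probability at least
    [m], and [G b] is constant on that history. Both expectations are finite sums over histories,
    compared term by term. *)
Lemma mixing_forward k t (m : R) (G : 'I_n -> T -> R) :
  (forall a b, m <= (P ^+ t) a b) -> (forall b w, 0 <= G b w) ->
  (forall b, adapted ik k (G b)) ->
  m * \int[Pr]_w (\sum_b G b w) <= \int[Pr]_w G (ik (k + t) w) w.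
Proof.
move=> hm G0 aG.
have {aG}/choice[c cE] b := adapted_factor (aG b).
(* On an empty cylinder the sign of [c b a] is unknown, but the probability is 0. *)
have c0 b a : 0 <= c b a * prob (cylinder a).
  have [->|] := eqVneq (cylinder a) set0; first by rewrite /prob measure0 mulr0.
  move=> /set0P[w /cylinderE <-]; rewrite -cE mulr_ge0// fine_ge0//.
have indE a w : \1_(cylinder a) w = (history k w == a)%:R :> R.
  by rewrite indicE; congr (nat_of_bool _)%:R; apply/idP/eqP;
    rewrite inE => h; apply/cylinderE.
have -> : \int[Pr]_w (\sum_b G b w) = \sum_a (\sum_b c b a) * prob (cylinder a).
  rewrite -Rintegral_indic_sum; last exact: measurable_cylinder.
  apply: eq_Rintegral => w _; rewrite (bigD1 (history k w))//= [X in _ = _ + X]big1 => [|a ah].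
    by rewrite indE eqxx mulr1 addr0; apply: eq_bigr => b _.
  by rewrite indE eq_sym (negPf ah) mulr0.
have -> : \int[Pr]_w G (ik (k + t) w) w = \sum_(ab : {ffun 'I_k.+1 -> 'I_n} * 'I_n)
    c ab.2 ab.1 * prob (cylinder ab.1 `&` [set w | ik (k + t) w = ab.2]).
  rewrite -Rintegral_indic_sum; last first.
    by move=> ab; apply: measurableI; [exact: measurable_cylinder|exact: measurable_visit].
  apply: eq_Rintegral => w _; rewrite (bigD1 (history k w, ik (k + t) w))//= big1 => [|[a b] ah].
    rewrite addr0 indicE mem_set ?mulr1//; split=> //; exact/cylinderE.
  rewrite indicE memNset ?mulr0// => -[/cylinderE /= ha hb].
  by rewrite ha hb eqxx in ah.
rewrite -(pair_bigA _ (fun a b => c b a * prob (cylinder a `&` [set w | ik (k + t) w = b])))/=.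
rewrite mulr_sumr; apply: ler_sum => a _; rewrite mulr_suml mulr_sumr.
apply: ler_sum => b _; rewrite markov_forward [m * _]mulrC mulrA.
by rewrite ler_wpM2l.
Qed.

End Chain.

(** * Expected rate *)

(** Uniqueness of the proximal points makes the set-valued updates deterministic. The induction
    carries [xbar] one index ahead because the next [x] is computed from it. *)
Lemma walkman_adapted (R : realType) (T : Type) (n p : nat) (var : variant)
    (beta L gamma : R) (f : 'I_n -> 'rV[R]_p -> R) (r : 'rV[R]_p -> \bar R)
    (ik : nat -> T -> 'I_n) (x0 : 'rV[R]_p) (y0 z0 : 'M[R]_(n, p))
    (x xbar : nat -> T -> 'rV[R]_p) (y z : nat -> T -> 'M[R]_(n, p)) :
  (forall u, r u != -oo%E) -> 0 <= L -> 0 < beta ->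
  admissible_beta var beta L gamma ->
  (forall i, lipschitz_differentiable L (f i)) -> semiconvex gamma r ->
  walkman var beta f r ik x0 y0 z0 x xbar y z ->
  forall k w w', (forall t, (t < k)%N -> ik t w = ik t w') ->
  [/\ x k w = x k w', y k w = y k w', z k w = z k w'
    & xbar k.+1 w = xbar k.+1 w'].
Proof.
move=> rNy L0 b0 hb lipf rcvx H k w w'.
have [gb Lb _ _] := admissible_gt L0 hb.
elim: k => [|k IH] hw.
  have [-> -> -> -> _] := H w; have [-> -> -> -> _] := H w'; by [].
have {IH}[_ yE zE xbE] := IH (fun t tk => hw t (leqW tk)).
have jE := hw k (ltnSn k).
have [_ _ _ _ /(_ k)] := H w; have [_ _ _ _ /(_ k)] := H w'.
rewrite /= -yE -zE -xbE -jE; move: (ik k w) => j.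
move=> [px' [uy' yi'] zj' zi' xb'] [px [uy yi] zj zi xb].
have xE : x k.+1 w = x k.+1 w' by exact: prox_unique rNy b0 gb rcvx px px'.
have yjE : row j (y k.+1 w) = row j (y k.+1 w').
  move: uy uy'; rewrite -xE /y_update; case: (var) => [h h'|-> ->//].
  by apply: prox_smooth_unique (lipf j) _ h h'; rewrite L0.
have zjE : row j (z k.+1 w) = row j (z k.+1 w') by rewrite zj zj' xE yjE.
split=> //.
- apply/row_matrixP => i; have [->//|ij] := eqVneq i j.
  by rewrite yi// yi'.
- apply/row_matrixP => i; have [->//|ij] := eqVneq i j.
  by rewrite zi// zi'.
by rewrite xb xb' yjE zjE.
Qed.

(** Some entry [pi_a] is positive and irreducibility gives an [m] with [P^m a b > 0], so
    [pi_b >= pi_a P^m a b > 0] by invariance. *)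
Lemma stationary_pi_min (R : realType) (n : nat) (P : 'M[R]_n) (pi : 'rV[R]_n) :
  stochastic_mx P -> irreducible P -> stationary P pi -> 0 < pi_min pi <= 1.
Proof.
move=> [P0 _] irr [pi0 pi1 piP].
apply/andP; split; last exact: bigmin_le_id.
have piPm m : pi *m (P ^+ m) = pi.
  elim: m => [|m IH]; first by rewrite expr0; exact: mulmx1.
  by rewrite exprSr [_ * P]/(_ *m P) mulmxA IH.
have Pm0 m a b : 0 <= (P ^+ m) a b.
  elim: m a b => [|m IH] a b; first by rewrite expr0 mxE ler0n.
  by rewrite exprS mxE; apply: sumr_ge0 => c _; rewrite mulr_ge0.
have [a pia] : exists a, 0 < pi 0 a.
  apply: contrapT => h; have : \sum_(a < n) pi 0 a <= 0.
    apply: sumr_le0 => a _; rewrite leNgt; apply/negP => ha; apply: h.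
    by exists a.
  by rewrite pi1 ler10.
apply: (big_ind (fun v => 0 < v)) => // [u v u0 v0|b _].
  by rewrite lt_min u0.
have [m hm] := irr a b.
rewrite -(piPm m) mxE (bigD1 a)//= ltr_wpDr ?mulr_gt0//.
by apply: sumr_ge0 => c _; rewrite mulr_ge0.
Qed.

(** * Sums over windows and the constants of the rate *)

Lemma sum_shift_le (R : realType) (F : nat -> R) (m N : nat) :
  (forall k, 0 <= F k) -> \sum_(k < N) F (m + k)%N <= \sum_(k < m + N) F k.
Proof.
by move=> F0; rewrite big_split_ord/= lerDr; apply: sumr_ge0.
Qed.

(** After exchanging the sums, each of the [tau + 1] shifts of [F] sums to at most [S]; with the
    factor [tau + 1] in front this gives [(tau + 1)^2 <= 2 (tau^2 + 1)]. The first term is enlarged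
    by [(tau^2 + 1) / theta >= 1] to share the factor. *)
Lemma window_sum_le (R : realType) (F : nat -> R) (C1 C2 C3 theta S : R)
    (tau K : nat) :
  0 <= C1 -> 0 <= C2 -> 0 <= C3 -> 0 < theta <= 1 -> (forall k, 0 <= F k) ->
  (forall N, \sum_(k < N) F k <= S) ->
  \sum_(k < K) (C1 * F k + C2 * (theta^-1 * (C3 * tau.+1%:R
    * (\sum_(s < tau) F (k.+1 + s)%N + F (k + tau)%N))))
  <= (C1 + 2 * C2 * C3) * ((tau%:R ^+ 2 + 1) / theta) * S.
Proof.
move=> C10 C20 C30 /andP[t0 t1] F0 FS.
have shiftS m : \sum_(k < K) F (m + k)%N <= S.
  by apply: le_trans (FS (m + K)%N); apply: sum_shift_le.
have S0 : 0 <= S by have := FS 0; rewrite big_ord0.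
rewrite big_split/= -!mulr_sumr big_split/= exchange_big/=.
have h1 : \sum_(s < tau) \sum_(k < K) F (k.+1 + s)%N <= tau%:R * S.
  rewrite mulr_natl -[X in _ *+ X]card_ord -sumr_const; apply: ler_sum => s _.
  apply: le_trans (shiftS s.+1); apply: ler_sum => k _.
  by rewrite addSnnS addnC.
have h2 : \sum_(k < K) F (k + tau)%N <= S.
  by apply: le_trans (shiftS tau); apply: ler_sum => k _; rewrite addnC.
have h3 := FS K.
have tau0 : 0 <= (tau%:R : R) by rewrite ler0n.
have tau1 : (tau.+1%:R : R) = tau%:R + 1 by rewrite -natr1.
have ti : 1 <= theta^-1 by rewrite invf_ge1.
have hA : \sum_(k < K) F k <= (tau%:R ^+ 2 + 1) / theta * S.
  apply: le_trans h3 _; rewrite ler_peMl// mulr_ege1//.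
  by rewrite lerDr sqr_ge0.
have hB : tau.+1%:R * (\sum_(s < tau) \sum_(k < K) F (k.+1 + s)%N
    + \sum_(k < K) F (k + tau)%N) <= 2 * (tau%:R ^+ 2 + 1) * S.
  apply: (@le_trans _ _ (tau.+1%:R * (tau.+1%:R * S))).
    by rewrite ler_wpM2l// tau1; lra.
  rewrite mulrA ler_wpM2r// tau1; have := sqr_ge0 (tau%:R - 1 : R); lra.
rewrite -(mulrA C3).
have := ler_wpM2l C10 hA.
have := ler_wpM2l C20 (ler_wpM2l (le_trans ler01 ti) (ler_wpM2l C30 hB)).
lra.
Qed.

(** The first factor is [C1 + 2 C2 C3] of [window_sum_le], the second comes from [increment_sum].
    The absolute value keeps the constant positive for all parameters. *)
Definition rate_factor (R : realType) (beta L gamma : R) : R :=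
  (2 * (1 + beta ^+ 2) + 6 * ((1 + beta) ^+ 2 + 1) * (1 + L) ^+ 2)
  * (2 / `|beta - gamma| + 2 * (1 + L ^+ 2)).

(** The denominator is [n theta] with [theta = (1 - delta) pistar]: of the [n^2] gained from the
    subgradient, one [n] is lost in the sum of increments. *)
Definition rate_constant (R : realType) (beta L gamma : R) (n tau : nat)
    (delta pistar : R) : R :=
  rate_factor beta L gamma
  * ((tau%:R ^+ 2 + 1) / ((1 - delta) * n%:R * pistar)).

Lemma rate_factor_gt0 (R : realType) (beta L gamma : R) :
  0 < rate_factor beta L gamma.
Proof.
have h0 := sqr_ge0 (1 + beta); have h1 := sqr_ge0 (1 + L).
have h2 := sqr_ge0 beta; have h3 := sqr_ge0 L.
apply: mulr_gt0.
  apply: ltr_pwDl; first by lra.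
  by rewrite mulr_ge0//; lra.
apply: ltr_wpDl; first by rewrite divr_ge0.
by lra.
Qed.

Section Rate.
Variables (R : realType) (d : measure_display) (T : measurableType d).
Variables (Pr : probability T R) (n p : nat) (f : 'I_n -> 'rV[R]_p -> R).
Variables (r : 'rV[R]_p -> \bar R) (ik : nat -> T -> 'I_n) (P : 'M[R]_n).
Variables (beta L gamma flow theta : R) (tau : nat) (var : variant).
Variables (x0 : 'rV[R]_p) (y0 z0 : 'M[R]_(n, p)).
Variables (x xbar : nat -> T -> 'rV[R]_p) (y z : nat -> T -> 'M[R]_(n, p)).
Hypothesis rNy : forall u, r u != -oo%E.
Hypothesis mc : markov_chain Pr ik P.
Hypothesis flow_le : forall u, (flow%:E <= objective f r u)%E.
Hypothesis lipf : forall i, lipschitz_differentiable L (f i).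
Hypothesis rcvx : semiconvex gamma r.
Hypothesis theta01 : 0 < theta <= 1.
Hypothesis mixing : forall a b, theta <= (P ^+ tau) a b.
Hypothesis beta0 : 0 < beta.
Hypothesis L0 : 0 <= L.
Hypothesis hbeta : admissible_beta var beta L gamma.
Hypothesis y0z0 : forall i, gradient (f i) (row i y0) = row i z0.
Hypothesis H : walkman var beta f r ik x0 y0 z0 x xbar y z.

Let state_eq := walkman_adapted rNy L0 beta0 hbeta lipf rcvx H.

Let traj w : walkman var beta f r (fun k (_ : unit) => ik k w) x0 y0 z0
  (fun k _ => x k w) (fun k _ => xbar k w) (fun k _ => y k w) (fun k _ => z k w).
Proof. by move=> _; exact: H. Qed.

Let g k w := walkman_subgradient beta f (fun k => x k w) (fun k => xbar k w)
  (fun k => y k w) (fun k => z k w) k.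

Let inc k w := increment (fun k => x k w) (fun k => y k w) (fun k => z k w) k.

Let res i k w := residual f (fun k => x k w) (fun k => y k w) (fun k => z k w) i k.

Lemma adapted_subgradient k : adapted ik k (g k).
Proof.
move=> w w' ww'; have [xE yE zE _] := state_eq (k := k.+1) ww'.
have [_ _ _ xbE] := state_eq (k := k) (fun t tk => ww' t (ltnW tk)).
by rewrite /g /walkman_subgradient xE yE zE xbE.
Qed.

Lemma adapted_increment k : adapted ik k (inc k).
Proof.
move=> w w' ww'; have [xE yE zE _] := state_eq (k := k.+1) ww'.
have [xE' yE' zE' _] := state_eq (k := k) (fun t tk => ww' t (ltnW tk)).
by rewrite /inc /increment xE yE zE xE' yE' zE'.
Qed.

Lemma adapted_residual i k : adapted ik k (res i k.+1).
Proof.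
move=> w w' ww'; have [xE yE zE _] := state_eq (k := k.+1) ww'.
by rewrite /res /residual xE yE zE.
Qed.

(** In expectation it dominates [n^2 |g|^2]: the sum of squared residuals is replaced by the window
    of the agent visited at [k + tau], at the price of [theta^-1]. *)
Let majorant k w : R :=
  2 * (1 + beta ^+ 2) * inc k w + ((1 + beta) ^+ 2 + 1) * (theta^-1 *
    (3 * (1 + L) ^+ 2 * tau.+1%:R
     * (\sum_(s < tau) inc (k.+1 + s) w + inc (k + tau) w))).

Lemma adapted_window k :
  adapted ik (k + tau) (fun w => \sum_(s < tau) inc (k.+1 + s) w + inc (k + tau) w).
Proof.
move=> w w' ww'; congr (_ + _); last exact: adapted_increment.
apply: eq_bigr => s _; apply: adapted_increment => t ts; apply: ww'.
by rewrite (leq_trans ts)// addSnnS leq_add2l.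
Qed.

Lemma adapted_majorant k : adapted ik (k + tau) (majorant k).
Proof.
move=> w w' ww'; rewrite /majorant (adapted_window ww').
rewrite (@adapted_increment k w w')// => t tk.
by apply: ww'; rewrite (leq_trans tk) ?leq_addr.
Qed.

Let integrable_of m (X : T -> R) : adapted ik m X ->
  Pr.-integrable setT (EFin \o X).
Proof. by move=> aX; apply: (adapted_integrable mc aX). Qed.

Lemma expected_subgradient_le k :
  n%:R ^+ 2 * \int[Pr]_w (enorm (g k w) ^+ 2) <= \int[Pr]_w majorant k w.
Proof.
have [t0 _] := andP theta01.
pose X w := \sum_i res i k.+1 w ^+ 2.
pose V w := \sum_(s < tau) inc (k.+1 + s) w + inc (k + tau) w.
have ag : adapted ik k (fun w => enorm (g k w) ^+ 2).
  by move=> w w' /adapted_subgradient ->.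
have aX : adapted ik k X.
  by move=> w w' ww'; apply: eq_bigr => i _; rewrite (adapted_residual i ww').
have aV : adapted ik (k + tau) V := @adapted_window k.
have aRes : adapted ik (k + tau) (fun w => res (ik (k + tau) w) k.+1 w ^+ 2).
  move=> w w' ww'; rewrite (ww' (k + tau)%N)// (@adapted_residual _ k w w')// => t tk.
  by apply: ww'; rewrite (leq_trans tk) ?leq_addr.
have ainc := @adapted_increment k.
(* The residuals at [k + 1] depend on the walk up to [k] only, so mixing over [tau] steps trades the
   sum of their squares for the single one of the agent visited at [k + tau]. *)
have mix : theta * \int[Pr]_w X w <= \int[Pr]_w (res (ik (k + tau) w) k.+1 w ^+ 2).
  apply: (mixing_forward mc (G := fun i w => res i k.+1 w ^+ 2)) => // [b w|b].
    exact: sqr_ge0.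
  by move=> w w' ww'; rewrite (adapted_residual b ww').
have hV : \int[Pr]_w X w <= theta^-1 * (3 * (1 + L) ^+ 2 * tau.+1%:R * \int[Pr]_w V w).
  rewrite ler_pdivlMl//; apply: le_trans mix _.
  rewrite -RintegralZl//; last exact: integrable_of aV.
  apply: le_Rintegral => //.
  - exact: integrable_of aRes.
  - by apply: (@integrable_of (k + tau)) => w w' /aV ->.
  move=> w _; exact: residual_forward_sq L0 beta0 hbeta lipf y0z0 (traj w) k tau.
apply: (@le_trans _ _ (2 * (1 + beta ^+ 2) * \int[Pr]_w inc k w
    + ((1 + beta) ^+ 2 + 1) * \int[Pr]_w X w)).
  rewrite -!RintegralZl//; try by [exact: integrable_of ag|exact: integrable_of ainc|exact: integrable_of aX].
  rewrite -RintegralD//; last 2 first.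
  - by apply: (@integrable_of k) => w w' /ainc ->.
  - by apply: (@integrable_of k) => w w' /aX ->.
  apply: le_Rintegral => //.
  - by apply: (@integrable_of k) => w w' /ag ->.
  - by apply: (@integrable_of k) => w w' ww'; rewrite (ainc _ _ ww') (aX _ _ ww').
  move=> w _; exact: walkman_subgradient_norm beta0 (traj w) k.
have iV : Pr.-integrable setT (EFin \o V) := integrable_of aV.
have iinc : Pr.-integrable setT (EFin \o inc k) := integrable_of ainc.
have iZ c m Y : adapted ik m Y -> Pr.-integrable setT (EFin \o (fun w => c * Y w)).
  by move=> aY; apply: (@integrable_of m) => w w' /aY ->.
have -> : \int[Pr]_w majorant k w = 2 * (1 + beta ^+ 2) * \int[Pr]_w inc k w
    + ((1 + beta) ^+ 2 + 1) * (theta^-1 *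
        (3 * (1 + L) ^+ 2 * tau.+1%:R * \int[Pr]_w V w)).
  rewrite -(RintegralZl _ measurableT iinc) -(RintegralZl _ measurableT iV).
  rewrite -RintegralZl//; last exact: iZ aV.
  rewrite -RintegralZl//; last by apply: (iZ _ _ _ (_ : adapted ik (k + tau) _)) => w w' /aV ->.
  rewrite -RintegralD//; first exact: iZ ainc.
  by apply: (@integrable_of (k + tau)) => w w' /aV ->.
by rewrite lerD2l ler_wpM2l// addr_ge0 ?sqr_ge0.
Qed.

(** The increments are summable on every path with the same bound, so no expectation is taken
    here. *)
Lemma majorant_sum w K : r x0 \is a fin_num ->
  \sum_(k < K) majorant k w <= n%:R
    * (fine (aug_lagrangian f r beta x0 y0 z0) - flow) * rate_factor beta L gamma
    * ((tau%:R ^+ 2 + 1) / theta).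
Proof.
move=> rx0; have [t0 t1] := andP theta01.
have [gb _ _ _] := admissible_gt L0 hbeta.
set S := n%:R * (fine (aug_lagrangian f r beta x0 y0 z0) - flow)
    * (2 / (beta - gamma) + 2 * (1 + L ^+ 2)).
have incS N : \sum_(k < N) inc k w <= S.
  rewrite /S (potential_0 L (traj w) rx0).
  exact: increment_sum rNy L0 beta0 hbeta lipf rcvx flow_le y0z0 (traj w) N rx0.
have inc0 k : 0 <= inc k w by exact: increment_ge0.
have Lb := sqr_ge0 (1 + L).
have := @window_sum_le _ (fun k => inc k w) (2 * (1 + beta ^+ 2))
  ((1 + beta) ^+ 2 + 1) (3 * (1 + L) ^+ 2) theta S tau K.
move=> /(_ _ _ _ theta01 inc0 incS) /le_trans; apply.
- by rewrite mulr_ge0 ?addr_ge0 ?sqr_ge0.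
- by rewrite addr_ge0 ?sqr_ge0.
- by rewrite mulr_ge0.
by rewrite /rate_factor gtr0_norm ?subr_gt0// /S le_eqVlt; apply/orP; left; apply/eqP; ring.
Qed.

Lemma expected_subgradient_sum K : r x0 \is a fin_num ->
  \sum_(k < K) \int[Pr]_w (enorm (g k w) ^+ 2) <=
  rate_factor beta L gamma * ((tau%:R ^+ 2 + 1) / (n%:R * theta))
  * (fine (aug_lagrangian f r beta x0 y0 z0) - flow).
Proof.
move=> rx0.
have sum_int : \sum_(k < K) \int[Pr]_w majorant k w
    = \int[Pr]_w (\sum_(k < K) majorant k w).
  elim: K => [|K IH].
    rewrite big_ord0; under eq_Rintegral do rewrite big_ord0.
    by rewrite Rintegral_cst// mul0r.
  under [RHS]eq_Rintegral do rewrite big_ord_recr/=.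
  rewrite big_ord_recr/= IH [RHS]RintegralD//.
    apply: (@integrable_of (K + tau)) => w w' ww'; apply: eq_bigr => k _.
    apply: adapted_majorant => t tk; apply: ww'; rewrite (leq_trans tk)//.
    by rewrite leq_add2r ltnW.
  exact: integrable_of (@adapted_majorant K).
have [w0 _] := probability_inhabited Pr.
have n0 : 0 < (n%:R : R) by rewrite ltr0n (leq_trans _ (ltn_ord (ik 0 w0))).
have [t0 _] := andP theta01.
set B := n%:R * (fine (aug_lagrangian f r beta x0 y0 z0) - flow)
  * rate_factor beta L gamma * ((tau%:R ^+ 2 + 1) / theta).
have : n%:R ^+ 2 * \sum_(k < K) \int[Pr]_w (enorm (g k w) ^+ 2) <= B.
  rewrite mulr_sumr; apply: (@le_trans _ _ (\sum_(k < K) \int[Pr]_w majorant k w)).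
    by apply: ler_sum => k _; exact: expected_subgradient_le.
  (* The pathwise bound is a constant, hence its own expectation. *)
  rewrite sum_int (_ : B = \int[Pr]_w B); last first.
    have PT : fine (Pr setT) = 1 by rewrite probability_setT.
    by rewrite Rintegral_cst// -[LHS]mulr1; congr (_ * _); exact: (esym PT).
  apply: le_Rintegral => //.
  - apply: (@integrable_of (K + tau)) => w w' ww'; apply: eq_bigr => k _.
    apply: adapted_majorant => t tk; apply: ww'; rewrite (leq_trans tk)//.
    by rewrite leq_add2r ltnW.
  - exact: (@integrable_of 0).
  - by move=> w _; exact: majorant_sum.
have n20 : 0 < (n%:R ^+ 2 : R) by rewrite exprn_gt0.
rewrite -ler_pdivlMl// => /le_trans; apply.
rewrite le_eqVlt; apply/orP; left; apply/eqP; rewrite /B; field.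
by rewrite !gt_eqF.
Qed.

End Rate.

(** * From the expected sum to the minimum *)

Lemma bigmin_le_mean (R : realType) (F : nat -> R) (B : R) (K : nat) :
  0 <= B -> (0 < K)%N -> \sum_(k < K.+1) F k <= B ->
  (\big[Order.min/+oo]_(k < K.+1) (F k)%:E <= (B / K%:R)%:E)%E.
Proof.
move=> B0 K0 FB.
have KR : 0 < (K%:R : R) by rewrite ltr0n.
have [k kB] : exists k : 'I_K.+1, F k <= B / K%:R.
  (* If all [K + 1] terms exceeded [B / K], the first [K] would sum to at least [B] and the last
     would be positive. *)
  apply: contrapT => /forallNP h.
  have hF k : (k < K.+1)%N -> B / K%:R < F k.
    by move=> kK; have := h (Ordinal kK) => /negP; rewrite -ltNge.
  suff : B < \sum_(k < K.+1) F k by rewrite ltNge FB.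
  rewrite big_ord_recr/=.
  have h1 : B <= \sum_(k < K) F k.
    have -> : B = \sum_(k < K) (B / K%:R).
      by rewrite sumr_const card_ord -[(_ / _) *+ _]mulr_natr divfK// gt_eqF.
    by apply: ler_sum => k _; apply/ltW/hF; rewrite (leq_trans (ltn_ord k)).
  have h2 := hF K (ltnSn K).
  have h3 : 0 <= B / K%:R by rewrite divr_ge0// ltW.
  lra.
apply: (le_trans (bigmin_le _ k _)).
by rewrite lee_fin.
Qed.

Lemma lipschitz_ge0 (R : realType) (p : nat) (L : R) (f : 'rV[R]_p -> R) :
  (0 < p)%N -> lipschitz_differentiable L f -> 0 <= L.
Proof.
move=> p0 [_ lip]; have := le_trans (enorm_ge0 _) (lip (const_mx 1) 0).
rewrite subr0; apply: contraTT; rewrite -!ltNge => L0.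
rewrite nmulr_rlt0// lt_def enorm_ge0 andbT; apply/eqP => /enorm_eq0 /matrixP.
by move=> /(_ 0 (Ordinal p0))/eqP; rewrite !mxE oner_eq0.
Qed.

Lemma expectation_Rintegral (R : realType) (d : measure_display)
    (T : measurableType d) (Pr : probability T R) (X : T -> R) :
  Pr.-integrable setT (EFin \o X) -> ('E_Pr[X] = (\int[Pr]_w X w)%:E)%E.
Proof.
by move=> iX; rewrite unlock /Rintegral fineK//; exact: integrable_fin_num.
Qed.

(** With [u = y] the correction of the potential vanishes, so [local_potential_ge] bounds the
    Lagrangian itself. This makes the right-hand side of the rate nonnegative, the case [r x0 = +oo]
    included. *)
Lemma aug_lagrangian_ge (R : realType) (n p : nat) (beta L flow : R) (f : 'I_n -> 'rV[R]_p -> R) (r : 'rV[R]_p -> \bar R)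
    (x0 : 'rV[R]_p) (y0 z0 : 'M[R]_(n, p)) :
  (0 < n)%N -> L + 1 <= beta ->
  (forall i, lipschitz_differentiable L (f i)) ->
  (forall u, (flow%:E <= objective f r u)%E) ->
  (forall i, gradient (f i) (row i y0) = row i z0) ->
  (flow%:E <= aug_lagrangian f r beta x0 y0 z0)%E.
Proof.
move=> n0 Lb lipf flow_le yz; apply: le_trans (flow_le x0) _.
rewrite leeD2l// lee_fin ler_pM2l ?invr_gt0 ?ltr0n//.
apply: ler_sum => i _; rewrite -yz.
have := local_potential_ge x0 (row i y0) (row i y0) (lipf i) Lb.
by rewrite /local_potential subrr enorm0 expr0n mulr0 addr0.
Qed.

Theorem theorem2 (R : realType) :
  exists Cbar : R -> R -> R -> nat -> nat -> R -> R -> R,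
  (forall beta L gamma : R, exists2 M : R, 0 < M &
     forall (n tau : nat) (delta pistar : R),
       (0 < n)%N -> 0 < delta < 1 -> 0 < pistar ->
       0 < Cbar beta L gamma n tau delta pistar
         <= M * ((tau%:R ^+ 2 + 1) / ((1 - delta) * n%:R * pistar)))
  /\
  forall (d : measure_display) (T : measurableType d) (Pr : probability T R)
    (n p : nat) (f : 'I_n -> 'rV[R]_p -> R) (r : 'rV[R]_p -> \bar R)
    (ik : nat -> T -> 'I_n) (P : 'M[R]_n) (pi : 'rV[R]_n)
    (beta L gamma flow delta : R) (tau : nat) (var : variant)
    (x0 : 'rV[R]_p) (y0 z0 : 'M[R]_(n, p))
    (x xbar : nat -> T -> 'rV[R]_p) (y z : nat -> T -> 'M[R]_(n, p)),
    (forall u, r u != -oo%E) ->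
    markov_chain Pr ik P -> irreducible P -> aperiodic P -> stationary P pi ->
    (forall u, (flow%:E <= objective f r u)%E) -> coercive (objective f r) ->
    (forall i, lipschitz_differentiable L (f i)) ->
    lower_semicontinuous r -> semiconvex gamma r ->
    0 < delta < 1 -> is_mixing_time P pi delta tau ->
    0 < beta -> admissible_beta var beta L gamma ->
    (forall i, gradient (f i) (row i y0) = beta *: row i y0) ->
    (forall i, beta *: row i y0 = row i z0) ->
    walkman var beta f r ik x0 y0 z0 x xbar y z ->
    exists g : nat -> T -> 'M[R]_(1 + (n + n), p),
      [/\ forall k a b, measurable_fun [set: T] (fun w => g k w a b),
          forall k w, subdifferential (aug_lagrangian_joint f r beta)
            (stack (x k.+1 w) (y k.+1 w) (z k.+1 w)) (g k w)
        & forall K : nat, (tau + 2 < K)%N ->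
            (\big[Order.min/+oo]_(k < K.+1)
                'E_Pr[fun w => (enorm (g k w) ^+ 2)%R]
             <= (Cbar beta L gamma n tau delta (pi_min pi) / K%:R)%:E
                * (aug_lagrangian f r beta x0 y0 z0 - flow%:E))%E].
Proof.
exists (@rate_constant R).
have rate_gt0 (beta L gamma delta pistar : R) n tau : (0 < n)%N -> 0 < delta < 1 ->
    0 < pistar -> 0 < rate_constant beta L gamma n tau delta pistar.
  move=> n0 /andP[d0 d1] pi0; apply: mulr_gt0; first exact: rate_factor_gt0.
  apply: divr_gt0; first by rewrite ltr_wpDl// sqr_ge0.
  by rewrite !mulr_gt0 ?ltr0n// subr_gt0.
split=> [beta L gamma|].
  exists (rate_factor beta L gamma) => [|n tau delta pistar n0 d01 pi0].
    exact: rate_factor_gt0.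
  by rewrite rate_gt0//= lexx.
move=> d T Pr n p f r ik P pi beta L gamma flow delta tau var x0 y0 z0 x xbar y z.
move=> rNy mc irr _ st flow_le _ lipf _ rcvx d01 [_ mix] b0 hb gy0 yz0 H.
have [w0 _] := probability_inhabited Pr.
have n0 : (0 < n)%N by rewrite (leq_trans _ (ltn_ord (ik 0 w0))).
have y0z0 i : gradient (f i) (row i y0) = row i z0 by rewrite gy0 yz0.
have [_ stP _] := mc.
have /andP[pi0 pi1] := stationary_pi_min stP irr st.
have C0 := rate_gt0 beta L gamma delta (pi_min pi) n tau n0 d01 pi0.
have Lb : L + 1 <= beta.
  have L20 := sqr_ge0 L; have L21 := sqr_ge0 (L + 1).
  case: var hb {H} => /= [[_ ?]|]; first by lra.
  by rewrite gt_max => /andP[_ ?]; lra.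
have Lflow := aug_lagrangian_ge x0 n0 Lb lipf flow_le y0z0.
(* With [p = 0] all matrices coincide, and the zero subgradient works. *)
have [p0|p0] := posnP p.
  have eqM m (u v : 'M[R]_(m, p)) : u = v.
    by move: u v; rewrite p0 => u v; rewrite (thinmx0 u) (thinmx0 v).
  exists (fun _ _ => 0); split=> [k a b|k w|K tK].
  - exact: measurable_cst.
  - apply: (@quadratic_minorant_subdifferential _ _ _ _ _ _ 0) => [|u].
      rewrite /aug_lagrangian_joint /stack !(col_mxKu, col_mxKd) fin_numD andbT.
      by have [_ _ _ _ /(_ k)[/(prox_fin rNy)]] := H w.
    by rewrite edot0l mul0r subr0 adde0 (eqM _ u (stack (x k.+1 w) (y k.+1 w) (z k.+1 w))).
  apply: (le_trans (bigmin_le _ ord0 _)).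
  rewrite enorm0 expr0n expectation_cst mule_ge0 ?sube_ge0 ?Lflow//.
  by rewrite lee_fin divr_ge0// ltW.
have L0 : 0 <= L := lipschitz_ge0 p0 (lipf (Ordinal n0)).
have [d0 d1] := andP d01.
pose theta := (1 - delta) * pi_min pi.
have theta01 : 0 < theta <= 1.
  by rewrite mulr_gt0 ?subr_gt0//= mulr_ile1// ?ltW// ?subr_ge0 ?ltW//; lra.
(* The mixing bound gives [P^tau a b >= pi_b - delta pi_min >= (1 - delta) pi_min]. *)
have mixing a b : theta <= (P ^+ tau) a b.
  have := mix a b; rewrite ler_distl => /andP[h _]; apply: le_trans h.
  by rewrite /theta; have := bigmin_le 1 b (fun a => pi 0 a); rewrite -/(pi_min pi); lra.
pose g k w := walkman_subgradient beta f (fun k => x k w) (fun k => xbar k w)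
  (fun k => y k w) (fun k => z k w) k.
have ag k : adapted ik k (g k).
  by move=> w w'; exact: (adapted_subgradient rNy lipf rcvx b0 L0 hb H).
exists g; split.
- move=> k a b; apply: (adapted_measurable mc (k := k)) => w w' /ag.
  by move=> ->.
- move=> k w; apply: (walkman_subgradientP rNy b0 lipf) => u.
  exact: H.
move=> K tK; have K0 : (0 < K)%N by rewrite (leq_trans _ tK).
have KR : 0 < (K%:R : R) by rewrite ltr0n.
(* If [r x0] is [+oo], so is the right-hand side of the rate. *)
have [rx0|] := boolP (r x0 \is a fin_num); last first.
  rewrite /aug_lagrangian; have := rNy x0; case: (r x0) => //= _ _.
  by rewrite gt0_muley ?leey// lte_fin divr_gt0.
have Lfin : aug_lagrangian f r beta x0 y0 z0 \is a fin_num by rewrite fin_numD rx0.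
move: Lflow; rewrite -[aug_lagrangian _ _ _ _ _ _]fineK// lee_fin => Lflow.
rewrite -EFinB -EFinM mulrAC.
under eq_bigr => k _.
  rewrite expectation_Rintegral; last first.
    by apply: (adapted_integrable mc (k := k)) => w w' /ag ->.
  over.
apply: (@bigmin_le_mean _ (fun k => \int[Pr]_w (enorm (g k w) ^+ 2))) => //.
  by rewrite mulr_ge0 ?subr_ge0// ltW.
have := expected_subgradient_sum rNy mc flow_le lipf rcvx theta01 mixing b0 L0 hb y0z0 H K.+1 rx0.
move=> /le_trans; apply; rewrite le_eqVlt; apply/orP; left; apply/eqP.
by rewrite /rate_constant /theta; congr (_ * (_ / _) * _); ring.
Qed.
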